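(* Let $f : \mathcal{E} \to \mathcal{S}$ be a geometric morphism between elementary toposes. Suppose that $\mathcal{E}$ has a natural numbers object. If $f$ is weakly Jacobson and $\mathcal{S}$ is EILC, then $\mathcal{E}$ is CILC.
   Context: A geometric morphism $f : \mathcal{F} \to \mathcal{E}$ between elementary toposes is essential if the inverse image functor $f^*$ has a left adjoint, written $f_!$. It is locally connected if it is essential and for all morphisms $A \to B$ in $\mathcal{E}$ and $X \to f^*B$ in $\mathcal{F}$ the natural morphism $f_!(X \times_{f^*B} f^*A) \to f_!(X) \times_B A$ is an isomorphism (here $f_!(X)\to B$ is the adjoint transpose of $X \to f^*B$). An elementary topos $\mathcal{E}$ is EILC if every essential geometric morphism $\mathcal{F} \to \mathcal{E}$ (with $\mathcal{F}$ an elementary topos) is locally connected. An elementary topos $\mathcal{E}$ is CILC if every geometric morphism $f : \mathcal{F} \to \mathcal{E}$ (with $\mathcal{F}$ an elementary topos) such that $f^*$ is cartesian closed (i.e. preserves exponential objects) is locally connected. A point of a geometric morphism $f : \mathcal{E} \to \mathcal{S}$ is a section of $f$, i.e. a geometric morphism $p : \mathcal{S} \to \mathcal{E}$ with $fp \simeq 1$. A family of geometric morphisms $\{p_i : \mathcal{E}_i \to \mathcal{E}\}_{i \in I}$ is jointly surjective if the inverse image functors $p_i^*$ jointly reflect isomorphisms. An étale geometric morphism is one of the form $\mathcal{E}/E \to \mathcal{E}$ for an object $E$ of $\mathcal{E}$, up to equivalence. A closed inclusion is the inclusion of a closed subtopos. A geometric morphism $f : \mathcal{E} \to \mathcal{S}$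 is weakly Jacobson if there is a jointly surjective family of points $\{p_i : \mathcal{S} \to \mathcal{E}\}_{i \in I}$ such that each $p_i$ can be factored as a closed inclusion followed by an étale geometric morphism. *)

(* Defs.v *)
From Stdlib Require Import ProofIrrelevance.

Set Implicit Arguments.
Unset Strict Implicit.
Unset Printing Implicit Defensive.

(** * Categories, functors, adjunctions *)

Declare Scope cat_scope.
Delimit Scope cat_scope with cat.
Local Open Scope cat_scope.

(** Equality of morphisms is Leibniz equality.  All categories, in particular
    all toposes quantified over below, live in one fixed pair of universes
    (one for objects, one for morphisms). *)
Record Category := {
  Ob :> Type;
  Hom : Ob -> Ob -> Type;
  idm : forall X, Hom X X;
  comp : forall X Y Z, Hom Y Z -> Hom X Y -> Hom X Z;
  comp_idl : forall X Y (u : Hom X Y), comp (idm Y) u = u;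
  comp_idr : forall X Y (u : Hom X Y), comp u (idm X) = u;
  comp_assoc : forall X Y Z W (w : Hom Z W) (v : Hom Y Z) (u : Hom X Y),
    comp w (comp v u) = comp (comp w v) u }.

Arguments Hom {c} X Y.
Arguments idm {c} X.
Arguments comp {c X Y Z} v u : rename.

Notation "v ∘ u" := (comp v u) (at level 40, left associativity) : cat_scope.

Record Functor (C D : Category) := {
  fob :> C -> D;
  fmap : forall X Y, Hom X Y -> Hom (fob X) (fob Y);
  fmap_id : forall X, fmap (idm X) = idm (fob X);
  fmap_comp : forall X Y Z (v : Hom Y Z) (u : Hom X Y),
    fmap (v ∘ u) = fmap v ∘ fmap u }.

Arguments fmap {C D} f {X Y} u : rename.

Definition functor_id (C : Category) : Functor C C.
Proof.
  refine {| fob := fun X => X; fmap := fun X Y u => u |}; reflexivity.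
Defined.

Definition functor_comp (C D E : Category) (G : Functor D E) (F : Functor C D) :
  Functor C E.
Proof.
  refine {| fob := fun X => G (F X); fmap := fun X Y u => fmap G (fmap F u) |}.
  - intros X; rewrite !fmap_id; reflexivity.
  - intros X Y Z v u; rewrite !fmap_comp; reflexivity.
Defined.

Definition IsIso (C : Category) (X Y : C) (u : Hom X Y) : Prop :=
  exists v : Hom Y X, v ∘ u = idm X /\ u ∘ v = idm Y.

Definition IsMono (C : Category) (X Y : C) (m : Hom X Y) : Prop :=
  forall (W : C) (u v : Hom W X), m ∘ u = m ∘ v -> u = v.

Definition NatIsomorphic (C D : Category) (F G : Functor C D) : Prop :=
  exists eta : forall X, Hom (F X) (G X),
    (forall X Y (u : Hom X Y), eta Y ∘ fmap F u = fmap G u ∘ eta X) /\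
    (forall X, IsIso (eta X)).

Definition IsEquivalence (C D : Category) (F : Functor C D) : Prop :=
  exists G : Functor D C,
    NatIsomorphic (functor_comp G F) (functor_id C) /\
    NatIsomorphic (functor_comp F G) (functor_id D).

(** [Adjunction L R] is the data exhibiting [L] as left adjoint to [R]. *)
Record Adjunction (C D : Category) (L : Functor C D) (R : Functor D C) := {
  adj_unit : forall X : C, Hom X (R (L X));
  adj_counit : forall Y : D, Hom (L (R Y)) Y;
  adj_unit_nat : forall (X X' : C) (u : Hom X X'),
    adj_unit X' ∘ u = fmap R (fmap L u) ∘ adj_unit X;
  adj_counit_nat : forall (Y Y' : D) (v : Hom Y Y'),
    v ∘ adj_counit Y = adj_counit Y' ∘ fmap L (fmap R v);
  triangle_l : forall X : C, adj_counit (L X) ∘ fmap L (adj_unit X) = idm (L X);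
  triangle_r : forall Y : D, fmap R (adj_counit Y) ∘ adj_unit (R Y) = idm (R Y) }.

Arguments adj_unit {C D L R} a X : rename.
Arguments adj_counit {C D L R} a Y : rename.

(** The transpose [L X -> Y] of [x : X -> R Y]. *)
Definition transpose (C D : Category) (L : Functor C D) (R : Functor D C)
  (a : Adjunction L R) (X : C) (Y : D) (x : Hom X (R Y)) : Hom (L X) Y :=
  adj_counit a Y ∘ fmap L x.

Definition adj_id (C : Category) : Adjunction (functor_id C) (functor_id C).
Proof.
  refine {| adj_unit := fun X : C => (idm X : Hom X (functor_id C (functor_id C X)));
            adj_counit := fun X : C => (idm X : Hom (functor_id C (functor_id C X)) X) |};
    intros; simpl; rewrite ?comp_idl, ?comp_idr; reflexivity.
Defined.

Definition adj_comp (C D E : Category)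
  (L : Functor C D) (R : Functor D C) (L' : Functor D E) (R' : Functor E D)
  (a : Adjunction L R) (a' : Adjunction L' R') :
  Adjunction (functor_comp L' L) (functor_comp R R').
Proof.
  refine (@Build_Adjunction C E (functor_comp L' L) (functor_comp R R')
    (fun X => fmap R (adj_unit a' (L X)) ∘ adj_unit a X)
    (fun Y => adj_counit a' Y ∘ fmap L' (adj_counit a (R' Y))) _ _ _ _); intros; simpl.
  - rewrite <- comp_assoc, (adj_unit_nat a), !comp_assoc, <- !fmap_comp, (adj_unit_nat a').
    reflexivity.
  - rewrite comp_assoc, (adj_counit_nat a'), <- !comp_assoc, <- !fmap_comp,
      (adj_counit_nat a).
    reflexivity.
  - rewrite (fmap_comp L), <- comp_assoc, <- (fmap_comp L'), comp_assoc,
      <- (adj_counit_nat a), <- comp_assoc, (triangle_l a), comp_idr.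
    apply (triangle_l a').
  - rewrite comp_assoc, <- (fmap_comp R), (fmap_comp R'), <- comp_assoc,
      <- (adj_unit_nat a'), comp_assoc, (triangle_r a'), comp_idl.
    apply (triangle_r a).
Defined.

(** * Limits, exponentials, subobject classifiers *)

Definition IsTerminal (C : Category) (T : C) : Prop :=
  forall X : C, exists ! u : Hom X T, True.

Definition IsProduct (C : Category) (A B P : C) (p1 : Hom P A) (p2 : Hom P B) : Prop :=
  forall (X : C) (a : Hom X A) (b : Hom X B),
    exists ! u : Hom X P, p1 ∘ u = a /\ p2 ∘ u = b.

(** The square [a ∘ p1 = b ∘ p2] is a pullback of the cospan [(a, b)]. *)
Definition IsPullback (C : Category) (A B D P : C) (a : Hom A D) (b : Hom B D)
  (p1 : Hom P A) (p2 : Hom P B) : Prop :=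
  a ∘ p1 = b ∘ p2 /\
  forall (X : C) (x : Hom X A) (y : Hom X B), a ∘ x = b ∘ y ->
    exists ! u : Hom X P, p1 ∘ u = x /\ p2 ∘ u = y.

(** [p1] and [p2] exhibit [P] as the product [X * A], and [ev : X * A -> B]
    exhibits [X] as the exponential [B ^ A]: every [g : Y * A -> B] is
    [ev ∘ (h * A)] for a unique [h : Y -> X].  Below, [k] is [h * A]. *)
Definition IsExponential (C : Category) (A B X P : C)
  (p1 : Hom P X) (p2 : Hom P A) (ev : Hom P B) : Prop :=
  IsProduct p1 p2 /\
  forall (Y Q : C) (q1 : Hom Q Y) (q2 : Hom Q A), IsProduct q1 q2 ->
    forall g : Hom Q B,
      exists ! h : Hom Y X,
        exists k : Hom Q P, p1 ∘ k = h ∘ q1 /\ p2 ∘ k = q2 /\ ev ∘ k = g.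

Definition IsSubobjectClassifier (C : Category) (T Omega : C) (t : Hom T Omega) : Prop :=
  IsTerminal T /\
  forall (A X : C) (m : Hom A X), IsMono m ->
    exists ! chi : Hom X Omega,
      exists bang : Hom A T, IsPullback chi t m bang.

(** Finite limits are given by a terminal object and pullbacks. *)
Record IsElementaryTopos (C : Category) : Prop := {
  has_terminal : exists T : C, IsTerminal T;
  has_pullbacks : forall (A B D : C) (a : Hom A D) (b : Hom B D),
    exists (P : C) (p1 : Hom P A) (p2 : Hom P B), IsPullback a b p1 p2;
  has_exponentials : forall A B : C,
    exists (X P : C) (p1 : Hom P X) (p2 : Hom P A) (ev : Hom P B),
      IsExponential p1 p2 ev;
  has_classifier : exists (T Omega : C) (t : Hom T Omega),
    IsSubobjectClassifier t }.

Record Topos := {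
  topos_cat :> Category;
  topos_axioms : IsElementaryTopos topos_cat }.

Definition HasNNO (C : Category) : Prop :=
  exists (T N : C) (z : Hom T N) (s : Hom N N),
    IsTerminal T /\
    forall (X : C) (a : Hom T X) (t : Hom X X),
      exists ! h : Hom N X, h ∘ z = a /\ h ∘ s = t ∘ h.

(** * Geometric morphisms *)

Record PreservesFiniteLimits (C D : Category) (F : Functor C D) : Prop := {
  pres_terminal : forall T : C, IsTerminal T -> IsTerminal (F T);
  pres_pullback : forall (A B X P : C) (a : Hom A X) (b : Hom B X)
    (p1 : Hom P A) (p2 : Hom P B),
    IsPullback a b p1 p2 ->
    IsPullback (fmap F a) (fmap F b) (fmap F p1) (fmap F p2) }.

Record GeomMor (F E : Topos) := {
  dir : Functor F E;
  inv : Functor E F;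
  inv_dir : Adjunction inv dir;
  inv_lex : PreservesFiniteLimits inv }.

Definition geom_id (E : Topos) : GeomMor E E.
Proof.
  refine {| dir := functor_id E; inv := functor_id E; inv_dir := adj_id E |}.
  split; intros; simpl; assumption.
Defined.

Definition geom_comp (G F E : Topos) (f : GeomMor F E) (g : GeomMor G F) :
  GeomMor G E.
Proof.
  refine {| dir := functor_comp (dir f) (dir g);
            inv := functor_comp (inv g) (inv f);
            inv_dir := adj_comp (inv_dir f) (inv_dir g) |}.
  split; intros; simpl.
  - apply (pres_terminal (inv_lex g)), (pres_terminal (inv_lex f)); assumption.
  - apply (pres_pullback (inv_lex g)), (pres_pullback (inv_lex f)); assumption.
Defined.

(** 2-cells of geometric morphisms are natural transformations between inverse
    images. *)
Definition GeomIso (F E : Topos) (f g : GeomMor F E) : Prop :=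
  NatIsomorphic (inv f) (inv g).

Definition IsEssential (F E : Topos) (f : GeomMor F E) : Prop :=
  exists L : Functor F E, inhabited (Adjunction L (inv f)).

(** For [u : A -> B] in [E] and [x : X -> f^* B] in [F], [P] is
    [X *_(f^* B) f^* A] and [Q] is [f_! X *_B A], for arbitrary choices of these
    pullbacks; [m] is the natural morphism [f_! P -> Q], the unique one with
    the two prescribed composites. *)
Definition IsLocallyConnected (F E : Topos) (f : GeomMor F E) : Prop :=
  exists (L : Functor F E) (a : Adjunction L (inv f)),
    forall (A B : E) (u : Hom A B) (X : F) (x : Hom X (inv f B))
      (P : F) (p1 : Hom P X) (p2 : Hom P (inv f A)),
      IsPullback x (fmap (inv f) u) p1 p2 ->
      forall (Q : E) (q1 : Hom Q (L X)) (q2 : Hom Q A),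
        IsPullback (transpose a x) u q1 q2 ->
        forall m : Hom (L P) Q,
          q1 ∘ m = fmap L p1 -> q2 ∘ m = transpose a p2 -> IsIso m.

(** Meaningful for functors preserving binary products, such as inverse
    images. *)
Definition PreservesExponentials (C D : Category) (F : Functor C D) : Prop :=
  forall (A B X P : C) (p1 : Hom P X) (p2 : Hom P A) (ev : Hom P B),
    IsExponential p1 p2 ev ->
    IsExponential (fmap F p1) (fmap F p2) (fmap F ev).

Definition EILC (E : Topos) : Prop :=
  forall (F : Topos) (f : GeomMor F E), IsEssential f -> IsLocallyConnected f.

Definition CILC (E : Topos) : Prop :=
  forall (F : Topos) (f : GeomMor F E),
    PreservesExponentials (inv f) -> IsLocallyConnected f.

(** * Étale geometric morphisms *)

Definition slice_ob (C : Category) (A : C) : Type := {X : C & Hom X A}.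

Definition slice_hom (C : Category) (A : C) (X Y : slice_ob A) : Type :=
  {u : Hom (projT1 X) (projT1 Y) | projT2 Y ∘ u = projT2 X}.

Lemma slice_hom_eq (C : Category) (A : C) (X Y : slice_ob A)
  (u v : slice_hom X Y) : proj1_sig u = proj1_sig v -> u = v.
Proof.
  destruct u as [u hu], v as [v hv]; simpl; intros <-.
  f_equal; apply proof_irrelevance.
Qed.

Definition slice_id (C : Category) (A : C) (X : slice_ob A) : slice_hom X X :=
  exist _ (idm (projT1 X)) (comp_idr (projT2 X)).

Definition slice_comp (C : Category) (A : C) (X Y Z : slice_ob A)
  (v : slice_hom Y Z) (u : slice_hom X Y) : slice_hom X Z.
Proof.
  refine (exist _ (proj1_sig v ∘ proj1_sig u) _).
  rewrite comp_assoc, (proj2_sig v); exact (proj2_sig u).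
Defined.

Definition Slice (C : Category) (A : C) : Category.
Proof.
  refine {| Ob := slice_ob A; Hom := @slice_hom C A;
            idm := @slice_id C A; comp := @slice_comp C A |};
    intros; apply slice_hom_eq; simpl.
  - apply comp_idl.
  - apply comp_idr.
  - apply comp_assoc.
Defined.

(** [H] is the functor [X |-> (X * A -> A)], for some choice of products. *)
Definition IsPullbackToSlice (C : Category) (A : C) (H : Functor C (Slice A)) : Prop :=
  exists pr : forall X : C, Hom (projT1 (H X)) X,
    (forall X : C, IsProduct (pr X) (projT2 (H X))) /\
    (forall (X Y : C) (u : Hom X Y), pr Y ∘ proj1_sig (fmap H u) = u ∘ pr X).

(** Up to an equivalence [K], [f] is the geometric morphism [E/A -> E] whose
    inverse image is [X |-> (X * A -> A)]. *)
Definition IsEtale (F E : Topos) (f : GeomMor F E) : Prop :=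
  exists (A : E) (H : Functor E (Slice A)) (K : Functor (Slice A) F),
    IsPullbackToSlice H /\ IsEquivalence K /\
    NatIsomorphic (inv f) (functor_comp K H).

(** * Closed inclusions *)

Definition FullSub (C : Category) (P : C -> Prop) : Category.
Proof.
  refine {| Ob := {X : C | P X};
            Hom := fun X Y => Hom (proj1_sig X) (proj1_sig Y);
            idm := fun X => idm (proj1_sig X);
            comp := fun X Y Z v u => v ∘ u |}; intros.
  - apply comp_idl.
  - apply comp_idr.
  - apply comp_assoc.
Defined.

Definition full_incl (C : Category) (P : C -> Prop) : Functor (FullSub P) C.
Proof.
  refine (@Build_Functor (FullSub P) C (fun X => proj1_sig X) (fun X Y u => u) _ _);
    reflexivity.
Defined.

Definition IsSubterminal (C : Category) (U : C) : Prop :=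
  forall (X : C) (u v : Hom X U), u = v.

(** The objects of the closed subtopos complementary to the open subtopos
    [E/U] (SGA 4, IV.9.3): those [X] for which [X * U -> U] is invertible. *)
Definition InClosedSubtopos (C : Category) (U X : C) : Prop :=
  forall (P : C) (p1 : Hom P X) (p2 : Hom P U), IsProduct p1 p2 -> IsIso p2.

(** Up to an equivalence [K], the direct image of [f] is the inclusion of the
    closed subtopos determined by a subterminal object. *)
Definition IsClosedInclusion (F E : Topos) (f : GeomMor F E) : Prop :=
  exists (U : E) (K : Functor F (FullSub (InClosedSubtopos U))),
    IsSubterminal U /\ IsEquivalence K /\
    NatIsomorphic (dir f) (functor_comp (full_incl (InClosedSubtopos U)) K).

(** * Weakly Jacobson geometric morphisms *)

Definition IsPoint (E S : Topos) (f : GeomMor E S) (p : GeomMor S E) : Prop :=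
  GeomIso (geom_comp f p) (geom_id S).

Definition JointlySurjective (E : Topos) (I : Type) (D : I -> Topos)
  (p : forall i, GeomMor (D i) E) : Prop :=
  forall (X Y : E) (u : Hom X Y),
    (forall i, IsIso (fmap (inv (p i)) u)) -> IsIso u.

Definition IsWeaklyJacobson (E S : Topos) (f : GeomMor E S) : Prop :=
  exists (I : Type) (p : I -> GeomMor S E),
    (forall i, IsPoint f (p i)) /\
    JointlySurjective p /\
    (forall i, exists (G : Topos) (c : GeomMor S G) (e : GeomMor G E),
       IsClosedInclusion c /\ IsEtale e /\ GeomIso (p i) (geom_comp e c)).

(* Main.v *)
(** Local connectedness of [f] means that arrows universal for [f^*] exist and
    are stable under pullback along maps [f^* v].

    If [g^* : E -> F] preserves exponentials, it has a left adjoint [g_!]: the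
    weakly universal arrow [ev : X -> g^* (Omega ^ A)], with
    [A = g_* ((g^* Omega) ^ X)], restricts to the internal intersection of the
    subobjects through which it factors, and [g^*] preserves that intersection.
    Moreover [g_! (X * g^* A) = g_! X * A], so [g_!] commutes with pullback
    along étale morphisms.

    Each point [p] of the given family identifies [S] with a closed subtopos of
    a slice [E/A].  Pulling [g] back along [p] gives a geometric morphism from
    the corresponding closed subtopos of [F / g^* A] to [S]; it is essential
    because [g] is, hence locally connected because [S] is EILC.  Closed
    subtoposes satisfy the Beck-Chevalley condition, so stability over [S] shows
    that [p^*] inverts the comparison morphism for [g].  As the points are
    jointly surjective, that morphism is invertible. *)

From Stdlib Require Import ssreflect ssrfun ssrbool ClassicalEpsilon.
Require Import Defs.

Set Implicit Arguments.
Unset Strict Implicit.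
Unset Printing Implicit Defensive.
Set Bullet Behavior "None".

Local Open Scope cat_scope.

(** * Universal arrows *)

(** EILC applies only to geometric morphisms whose domain is a topos, so slices and closed
    subtoposes have to be shown to be toposes; this is done with generalized elements and predicates
    represented by maps to the truth values. The delicate point is the exactness of the reflection
    onto a closed subtopos. No formula for that reflection is used: it comes from the same
    intersection argument as [g_!], since the inclusion of a closed subtopos is itself lex and
    cartesian closed. The exactness is expressed by the maps that the reflection inverts, described
    as the maps orthogonal to all closed objects: they are stable under pullback, and hence pass to
    the map induced between two pullbacks. The Beck-Chevalley condition takes the form that [g^*]
    sends reflection units to orthogonal maps, which holds because direct images keep objects
    closed. Universal arrows stand in for left adjoints throughout, as they compose and cancel
    without a choice of values, and a map that carries one universal arrow out of an object to
    another is invertible. *)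

Lemma comp_pre (C : Category) (X Y Z W : C) (a : Hom Y Z) (b : Hom X Y) (c : Hom X Z)
  (h : a ∘ b = c) (w : Hom W X) : a ∘ (b ∘ w) = c ∘ w.
Proof. by rewrite comp_assoc h. Qed.

Lemma fmap_sq (C D : Category) (F : Functor C D) (X Y Y' Z : C)
  (a : Hom Y Z) (b : Hom X Y) (c : Hom Y' Z) (d : Hom X Y') (h : a ∘ b = c ∘ d) :
  fmap F a ∘ fmap F b = fmap F c ∘ fmap F d.
Proof. by rewrite -!fmap_comp h. Qed.

Lemma iso_id (C : Category) (X : C) : IsIso (idm X).
Proof. by exists (idm X); rewrite !comp_idl. Qed.

Lemma iso_comp (C : Category) (X Y Z : C) (v : Hom Y Z) (u : Hom X Y) :
  IsIso v -> IsIso u -> IsIso (v ∘ u).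
Proof.
move=> [v' [hv1 hv2]] [u' [hu1 hu2]]; exists (u' ∘ v'); split.
- by rewrite -comp_assoc (comp_pre hv1) comp_idl.
- by rewrite -comp_assoc (comp_pre hu2) comp_idl.
Qed.

Lemma iso_fmap (C D : Category) (F : Functor C D) (X Y : C) (u : Hom X Y) :
  IsIso u -> IsIso (fmap F u).
Proof. by move=> [v [h1 h2]]; exists (fmap F v); rewrite -!fmap_comp h1 h2 !fmap_id. Qed.

Lemma iso_mono (C : Category) (X Y : C) (u : Hom X Y) : IsIso u -> IsMono u.
Proof.
by move=> [v [h1 _]] W a b h; rewrite -(comp_idl a) -(comp_idl b) -h1 -!comp_assoc h.
Qed.

Lemma natiso_iso (C D : Category) (F G : Functor C D) (X Y : C) (u : Hom X Y) :
  NatIsomorphic F G -> IsIso (fmap G u) -> IsIso (fmap F u).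
Proof.
move=> [eta [nat iso]] h.
case: (iso Y) => w [hw1 hw2].
have -> : fmap F u = w ∘ (fmap G u ∘ eta X) by rewrite -nat (comp_pre hw1) comp_idl.
apply: iso_comp; first by exists (eta Y).
by apply: iso_comp.
Qed.

Lemma natiso_sym (C D : Category) (F G : Functor C D) :
  NatIsomorphic F G -> NatIsomorphic G F.
Proof.
move=> [eta [nat iso]].
pose inv X := proj1_sig (constructive_indefinite_description _ (iso X)).
have hinv X : inv X ∘ eta X = idm (F X) /\ eta X ∘ inv X = idm (G X).
  by rewrite /inv; case: constructive_indefinite_description.
exists inv; split; last by move=> X; exists (eta X); case: (hinv X).
move=> X Y u.
rewrite -(comp_idr (inv Y ∘ _)) -(proj2 (hinv X)) -comp_assoc (comp_assoc (fmap G u)) -nat.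
by rewrite !comp_assoc (proj1 (hinv Y)) comp_idl.
Qed.

Lemma natiso_trans (C D : Category) (F G H : Functor C D) :
  NatIsomorphic F G -> NatIsomorphic G H -> NatIsomorphic F H.
Proof.
move=> [a [na ia]] [b [nb ib]]; exists (fun X => b X ∘ a X); split.
- by move=> X Y u; rewrite -comp_assoc na !comp_assoc nb.
- by move=> X; apply: iso_comp.
Qed.

Lemma natiso_comp (C D E : Category) (F F' : Functor C D) (G G' : Functor D E) :
  NatIsomorphic F F' -> NatIsomorphic G G' ->
  NatIsomorphic (functor_comp G F) (functor_comp G' F').
Proof.
move=> [a [na ia]] [b [nb ib]]; exists (fun X => b (F' X) ∘ fmap G (a X)); split.
- move=> X Y u /=.
  by rewrite -comp_assoc -fmap_comp na fmap_comp comp_assoc nb comp_assoc.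
- by move=> X; apply: iso_comp => //; apply: iso_fmap.
Qed.

Lemma natiso_refl (C D : Category) (F : Functor C D) : NatIsomorphic F F.
Proof.
by exists (fun X => idm _); split=> [X Y u|X]; [rewrite comp_idl comp_idr|apply: iso_id].
Qed.

Definition IsUniversal (C D : Category) (R : Functor D C) (X : C) (L : D)
  (eta : Hom X (R L)) : Prop :=
  forall (Y : D) (x : Hom X (R Y)), exists ! y : Hom L Y, fmap R y ∘ eta = x.

Definition IsCouniversal (C D : Category) (L : Functor C D) (Y : D) (Z : C)
  (eps : Hom (L Z) Y) : Prop :=
  forall (X : C) (y : Hom (L X) Y), exists ! x : Hom X Z, eps ∘ fmap L x = y.

Lemma ex_unique (T : Type) (P : T -> Prop) (x : T) :
  P x -> (forall y, P y -> x = y) -> exists ! x, P x.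
Proof. by move=> h1 h2; exists x; split. Qed.

Lemma unique_eq (T : Type) (P : T -> Prop) (x y : T) :
  (exists ! x, P x) -> P x -> P y -> x = y.
Proof. by move=> [z [_ h]] /h <- /h <-. Qed.

Lemma unit_universal (C D : Category) (L : Functor C D) (R : Functor D C)
  (a : Adjunction L R) (X : C) : IsUniversal (adj_unit a X).
Proof.
move=> Y x; apply: (@ex_unique _ _ (transpose a x)).
- by rewrite /transpose fmap_comp -comp_assoc -(adj_unit_nat a) comp_assoc (triangle_r a) comp_idl.
- move=> y <-; rewrite /transpose fmap_comp comp_assoc -(adj_counit_nat a) -comp_assoc.
  by rewrite (triangle_l a) comp_idr.
Qed.

Lemma counit_couniversal (C D : Category) (L : Functor C D) (R : Functor D C)
  (a : Adjunction L R) (Y : D) : IsCouniversal (adj_counit a Y).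
Proof.
move=> X y; apply: (@ex_unique _ _ (fmap R y ∘ adj_unit a X)).
- by rewrite fmap_comp comp_assoc -(adj_counit_nat a) -comp_assoc (triangle_l a) comp_idr.
- move=> x <-; rewrite fmap_comp -comp_assoc -(adj_unit_nat a) comp_assoc.
  by rewrite (triangle_r a) comp_idl.
Qed.

Arguments unit_universal {C D L R} a X.
Arguments counit_couniversal {C D L R} a Y.

Lemma universal_eq (C D : Category) (R : Functor D C) (X : C) (L : D)
  (eta : Hom X (R L)) (Y : D) (y y' : Hom L Y) :
  IsUniversal eta -> fmap R y ∘ eta = fmap R y' ∘ eta -> y = y'.
Proof. by move=> h e; apply: (unique_eq (h Y (fmap R y' ∘ eta))). Qed.

Lemma couniversal_eq (C D : Category) (L : Functor C D) (Y : D) (Z : C)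
  (eps : Hom (L Z) Y) (X : C) (x x' : Hom X Z) :
  IsCouniversal eps -> eps ∘ fmap L x = eps ∘ fmap L x' -> x = x'.
Proof. by move=> h e; apply: (unique_eq (h X (eps ∘ fmap L x'))). Qed.

(** Choice turns the existence of a universal arrow at each object into a function; the action on
    maps and all equations are forced by uniqueness. *)
Lemma left_adjoint_exists (C D : Category) (R : Functor D C) :
  (forall X : C, exists (L : D) (eta : Hom X (R L)), IsUniversal eta) ->
  exists L : Functor C D, inhabited (Adjunction L R).
Proof.
move=> h.
have h1 X : exists p : {L : D & Hom X (R L)}, IsUniversal (projT2 p).
  by case: (h X) => L [eta u]; exists (existT _ L eta).
pose c X := constructive_indefinite_description _ (h1 X).
pose L X := projT1 (proj1_sig (c X)); pose eta X : Hom X (R (L X)) := projT2 (proj1_sig (c X)).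
have hu X : IsUniversal (eta X) := proj2_sig (c X).
pose tr X Y (x : Hom X (R Y)) := constructive_indefinite_description _ (hu X Y x).
pose t X Y (x : Hom X (R Y)) : Hom (L X) Y := proj1_sig (tr X Y x).
have ht X Y (x : Hom X (R Y)) : fmap R (t X Y x) ∘ eta X = x.
  by case: (proj2_sig (tr X Y x)).
have te X Y (y y' : Hom (L X) Y) : fmap R y ∘ eta X = fmap R y' ∘ eta X -> y = y'.
  exact: universal_eq.
have l1 X : t X (L X) (eta X ∘ idm X) = idm (L X).
  by apply: te; rewrite ht fmap_id comp_idl comp_idr.
have l2 X Y Z (v : Hom Y Z) (u : Hom X Y) :
  t X _ (eta Z ∘ (v ∘ u)) = t Y _ (eta Z ∘ v) ∘ t X _ (eta Y ∘ u).
  by apply: te; rewrite ht fmap_comp -comp_assoc ht (comp_pre (ht _ _ _)) !comp_assoc.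
pose LF := @Build_Functor C D L (fun X Y u => t X (L Y) (eta Y ∘ u)) l1 l2.
exists LF; constructor.
refine (@Build_Adjunction C D LF R eta (fun Y => t (R Y) Y (idm (R Y))) _ _ _ _).
- by move=> X X' u /=; rewrite ht.
- move=> Y Y' v /=; apply: te; rewrite !fmap_comp -!comp_assoc !ht.
  by rewrite (comp_pre (ht _ _ _)) comp_idl comp_idr.
- move=> X /=; apply: te; rewrite !fmap_comp -!comp_assoc !ht (comp_pre (ht _ _ _)).
  by rewrite fmap_id comp_idl.
- by move=> Y /=; rewrite ht.
Qed.

Lemma right_adjoint_exists (C D : Category) (L : Functor C D) :
  (forall Y : D, exists (Z : C) (eps : Hom (L Z) Y), IsCouniversal eps) ->
  exists R : Functor D C, inhabited (Adjunction L R).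
Proof.
move=> h.
have h1 Y : exists p : {Z : C & Hom (L Z) Y}, IsCouniversal (projT2 p).
  by case: (h Y) => Z [eps u]; exists (existT _ Z eps).
pose c Y := constructive_indefinite_description _ (h1 Y).
pose R Y := projT1 (proj1_sig (c Y)); pose eps Y : Hom (L (R Y)) Y := projT2 (proj1_sig (c Y)).
have hu Y : IsCouniversal (eps Y) := proj2_sig (c Y).
pose tr X Y (y : Hom (L X) Y) := constructive_indefinite_description _ (hu Y X y).
pose t X Y (y : Hom (L X) Y) : Hom X (R Y) := proj1_sig (tr X Y y).
have ht X Y (y : Hom (L X) Y) : eps Y ∘ fmap L (t X Y y) = y.
  by case: (proj2_sig (tr X Y y)).
have te X Y (x x' : Hom X (R Y)) : eps Y ∘ fmap L x = eps Y ∘ fmap L x' -> x = x'.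
  exact: couniversal_eq.
have l1 X : t (R X) X (idm X ∘ eps X) = idm (R X).
  by apply: te; rewrite ht fmap_id comp_idl comp_idr.
have l2 X Y Z (v : Hom Y Z) (u : Hom X Y) :
  t (R X) _ ((v ∘ u) ∘ eps X) = t (R Y) _ (v ∘ eps Y) ∘ t (R X) _ (u ∘ eps X).
  by apply: te; rewrite ht fmap_comp comp_assoc ht -!comp_assoc ht.
pose RF := @Build_Functor D C R (fun X Y u => t (R X) Y (u ∘ eps X)) l1 l2.
exists RF; constructor.
refine (@Build_Adjunction C D L RF (fun X => t X (L X) (idm (L X))) eps _ _ _ _).
- move=> X X' u /=; apply: te; rewrite !fmap_comp !comp_assoc !ht.
  by rewrite -comp_assoc ht comp_idl comp_idr.
- by move=> Y Y' v /=; rewrite ht.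
- by move=> X /=; rewrite ht.
- move=> Y /=; apply: te; rewrite !fmap_comp !comp_assoc ht -comp_assoc ht.
  by rewrite fmap_id.
Qed.

Lemma universal_iso (C D : Category) (R : Functor D C) (X : C) (L L' : D)
  (eta : Hom X (R L)) (eta' : Hom X (R L')) (m : Hom L L') :
  IsUniversal eta -> IsUniversal eta' -> fmap R m ∘ eta = eta' -> IsIso m.
Proof.
move=> h h' e; case: (h' L eta) => n [hn _]; exists n; split.
- by apply: (universal_eq h); rewrite fmap_comp -comp_assoc e hn fmap_id comp_idl.
- by apply: (universal_eq h'); rewrite fmap_comp -comp_assoc hn e fmap_id comp_idl.
Qed.

Lemma iso_universal (C D : Category) (R : Functor D C) (X : C) (L L' : D)
  (eta : Hom X (R L)) (eta' : Hom X (R L')) (m : Hom L L') :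
  IsUniversal eta -> IsIso m -> fmap R m ∘ eta = eta' -> IsUniversal eta'.
Proof.
move=> h [n [nm mn]] e Y x; case: (h Y x) => y [hy uy]; apply: (@ex_unique _ _ (y ∘ n)).
- by rewrite fmap_comp -comp_assoc -e (comp_assoc _ (fmap R m)) -fmap_comp nm fmap_id comp_idl.
- move=> z hz; rewrite (uy (z ∘ m)) ?fmap_comp -?comp_assoc ?e ?hz //.
  by rewrite mn comp_idr.
Qed.

Lemma universal_comp (B C D : Category) (R : Functor C B) (R' : Functor D C)
  (X : B) (L : C) (L' : D) (eta : Hom X (R L)) (eta' : Hom L (R' L')) :
  IsUniversal eta -> IsUniversal eta' ->
  @IsUniversal B D (functor_comp R R') X L' (fmap R eta' ∘ eta).
Proof.
move=> h h' Y x; case: (h _ x) => z [hz uz]; case: (h' _ z) => y [hy uy].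
apply: (@ex_unique _ _ y) => [|y' e].
- by rewrite /= comp_assoc -fmap_comp hy.
- by apply: uy; apply/esym/uz; rewrite fmap_comp -comp_assoc.
Qed.

(** When [eta] is a reflection map, this lets universality for the composite functor descend to the
    reflective subcategory. *)
Lemma universal_cancel (B C D : Category) (R : Functor C B) (R' : Functor D C)
  (X : B) (L : C) (L' : D) (eta : Hom X (R L)) (eta' : Hom L (R' L')) :
  IsUniversal eta -> @IsUniversal B D (functor_comp R R') X L' (fmap R eta' ∘ eta) ->
  IsUniversal eta'.
Proof.
move=> h h' Y x; case: (h' _ (fmap R x ∘ eta)) => y [hy uy].
apply: (@ex_unique _ _ y) => [|y' e].
- by apply: (universal_eq h); rewrite fmap_comp -comp_assoc.
- by apply: uy; rewrite /= comp_assoc -fmap_comp e.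
Qed.

(** * Pullbacks and local connectedness *)

Lemma pullback_comm (C : Category) (A B D P : C) (a : Hom A D) (b : Hom B D)
  (p1 : Hom P A) (p2 : Hom P B) : IsPullback a b p1 p2 -> a ∘ p1 = b ∘ p2.
Proof. by case. Qed.

Lemma pullback_ex (C : Category) (A B D P : C) (a : Hom A D) (b : Hom B D)
  (p1 : Hom P A) (p2 : Hom P B) (X : C) (x : Hom X A) (y : Hom X B) :
  IsPullback a b p1 p2 -> a ∘ x = b ∘ y -> exists u, p1 ∘ u = x /\ p2 ∘ u = y.
Proof. by move=> [_ h] /h [u [hu _]]; exists u. Qed.

Lemma pullback_eq (C : Category) (A B D P : C) (a : Hom A D) (b : Hom B D)
  (p1 : Hom P A) (p2 : Hom P B) (X : C) (u v : Hom X P) :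
  IsPullback a b p1 p2 -> p1 ∘ u = p1 ∘ v -> p2 ∘ u = p2 ∘ v -> u = v.
Proof.
move=> [e h] h1 h2; have ev : a ∘ (p1 ∘ v) = b ∘ (p2 ∘ v) by rewrite !comp_assoc e.
exact: (unique_eq (h _ _ _ ev)).
Qed.

Lemma pullback_intro (C : Category) (A B D P : C) (a : Hom A D) (b : Hom B D)
  (p1 : Hom P A) (p2 : Hom P B) :
  a ∘ p1 = b ∘ p2 ->
  (forall (X : C) (x : Hom X A) (y : Hom X B), a ∘ x = b ∘ y ->
     exists u, p1 ∘ u = x /\ p2 ∘ u = y) ->
  (forall (X : C) (u v : Hom X P), p1 ∘ u = p1 ∘ v -> p2 ∘ u = p2 ∘ v -> u = v) ->
  IsPullback a b p1 p2.
Proof.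
move=> e h1 h2; split=> // X x y /h1 [u [hx hy]]; apply: (@ex_unique _ _ u) => //.
by move=> v [hx' hy']; apply: h2; rewrite ?hx ?hy.
Qed.

(** Local connectedness with no functor [f_!] chosen: universality of [p2] says that [f_!] takes [P]
    to [Q]. It is enough to pull back universal arrows, because any [X -> f^*B] factors through
    one. *)
Definition UniversalsStable (C D : Category) (R : Functor D C) : Prop :=
  forall (X : C) (L : D) (eta : Hom X (R L)), IsUniversal eta ->
  forall (Q : D) (v : Hom Q L) (P : C) (p1 : Hom P X) (p2 : Hom P (R Q)),
    IsPullback eta (fmap R v) p1 p2 -> IsUniversal p2.

Lemma transpose_unit (C D : Category) (L : Functor C D) (R : Functor D C)
  (a : Adjunction L R) (X : C) (Y : D) (x : Hom X (R Y)) :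
  fmap R (transpose a x) ∘ adj_unit a X = x.
Proof.
by rewrite /transpose fmap_comp -comp_assoc -(adj_unit_nat a) comp_assoc (triangle_r a) comp_idl.
Qed.

Lemma transpose_comp (C D : Category) (L : Functor C D) (R : Functor D C)
  (a : Adjunction L R) (X X' : C) (Y : D) (x : Hom X (R Y)) (u : Hom X' X) :
  transpose a (x ∘ u) = transpose a x ∘ fmap L u.
Proof. by rewrite /transpose fmap_comp comp_assoc. Qed.

Lemma transpose_fmap (C D : Category) (L : Functor C D) (R : Functor D C)
  (a : Adjunction L R) (X : C) (Y Y' : D) (x : Hom X (R Y)) (v : Hom Y Y') :
  transpose a (fmap R v ∘ x) = v ∘ transpose a x.
Proof. by rewrite /transpose fmap_comp !comp_assoc -(adj_counit_nat a). Qed.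

Lemma locally_connected_stable (F E : Topos) (f : GeomMor F E) :
  IsLocallyConnected f -> UniversalsStable (inv f).
Proof.
move=> [L [a h]] X L0 eta ueta Q v P p1 p2 pb.
have iso0 : IsIso (transpose a eta).
  exact (universal_iso (unit_universal a X) ueta (transpose_unit a eta)).
case: (iso0) => j [j1 j2].
(* Since [transpose a eta] is invertible, [Q] itself, with legs [j ∘ v] and the identity, is a
   pullback to which the hypothesis applies. *)
have isop : IsIso (transpose a p2).
  apply: (h Q L0 v X eta P p1 p2 pb Q (j ∘ v) (idm Q)).
  - apply: pullback_intro.
    + by rewrite (comp_pre j2) comp_idl comp_idr.
    + move=> T x y e; exists y; rewrite comp_idl; split=> //.
      by rewrite -comp_assoc -e (comp_pre j1) comp_idl.
    + by move=> T x y _; rewrite !comp_idl.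
  - apply: (iso_mono iso0); rewrite -comp_assoc (comp_pre j2) comp_idl.
    by rewrite -transpose_comp (pullback_comm pb) transpose_fmap.
  - by rewrite comp_idl.
exact (iso_universal (unit_universal a P) isop (transpose_unit a p2)).
Qed.

Lemma stable_locally_connected (F E : Topos) (f : GeomMor F E) :
  (forall X : F, exists (L : E) (eta : Hom X (inv f L)), IsUniversal eta) ->
  UniversalsStable (inv f) -> IsLocallyConnected f.
Proof.
move=> /left_adjoint_exists [L [a]] h; exists L, a.
move=> A B u X x P p1 p2 pb Q q1 q2 pbQ m hm1 hm2.
have pbR := pres_pullback (inv_lex f) pbQ.
have tx := transpose_unit a x.
have [|n [hn1 hn2]] := @pullback_ex _ _ _ _ _ _ _ _ _ _ (adj_unit a X ∘ p1) p2 pbR.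
  by rewrite comp_assoc tx (pullback_comm pb).
(* Pullback pasting: [x] is the unit followed by [f^*] of its transpose, so [P] is also the pullback
   of the unit along [fmap (inv f) q1]. *)
have un : IsUniversal n.
  apply: (h _ _ _ (unit_universal a X) _ q1 _ p1); apply: pullback_intro.
  - by rewrite hn1.
  - move=> T y z e.
    have [|w [hw1 hw2]] := @pullback_ex _ _ _ _ _ _ _ _ _ _ y (fmap (inv f) q2 ∘ z) pb.
      by rewrite -tx -comp_assoc e !comp_assoc -!fmap_comp (pullback_comm pbQ).
    exists w; split=> //; apply: (pullback_eq pbR).
    + by rewrite (comp_pre hn1) -comp_assoc hw1.
    + by rewrite (comp_pre hn2) hw2.
  - move=> T w w' e1 e2; apply: (pullback_eq pb) => //.
    by rewrite -hn2 -!comp_assoc e2.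
apply (fun e => universal_iso (unit_universal a P) un e).
apply: (pullback_eq pbR).
- by rewrite comp_assoc -fmap_comp hm1 hn1 (adj_unit_nat a).
- by rewrite comp_assoc -fmap_comp hm2 hn2 transpose_unit.
Qed.

(** * Products and exponentials in a topos *)

Lemma product_ex (C : Category) (A B P : C) (p1 : Hom P A) (p2 : Hom P B)
  (X : C) (x : Hom X A) (y : Hom X B) :
  IsProduct p1 p2 -> exists u, p1 ∘ u = x /\ p2 ∘ u = y.
Proof. by move=> /(_ X x y) [u [hu _]]; exists u. Qed.

Lemma product_eq (C : Category) (A B P : C) (p1 : Hom P A) (p2 : Hom P B)
  (X : C) (u v : Hom X P) :
  IsProduct p1 p2 -> p1 ∘ u = p1 ∘ v -> p2 ∘ u = p2 ∘ v -> u = v.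
Proof. by move=> h h1 h2; apply: (unique_eq (h X (p1 ∘ v) (p2 ∘ v))). Qed.

Lemma product_intro (C : Category) (A B P : C) (p1 : Hom P A) (p2 : Hom P B) :
  (forall (X : C) (x : Hom X A) (y : Hom X B), exists u, p1 ∘ u = x /\ p2 ∘ u = y) ->
  (forall (X : C) (u v : Hom X P), p1 ∘ u = p1 ∘ v -> p2 ∘ u = p2 ∘ v -> u = v) ->
  IsProduct p1 p2.
Proof.
move=> h1 h2 X x y; case: (h1 X x y) => u [hx hy].
by exists u; split=> // v [hx' hy']; apply: h2; rewrite ?hx ?hy.
Qed.

Lemma terminal_eq (C : Category) (T X : C) (u v : Hom X T) : IsTerminal T -> u = v.
Proof. by move=> /(_ X) h; apply: (unique_eq h). Qed.

Lemma terminal_pullback_product (C : Category) (T A B P : C) (a : Hom A T) (b : Hom B T)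
  (p1 : Hom P A) (p2 : Hom P B) :
  IsTerminal T -> IsPullback a b p1 p2 -> IsProduct p1 p2.
Proof.
move=> hT h; apply: product_intro => [X x y|X u v h1 h2].
- by apply: (pullback_ex h); apply: terminal_eq.
- exact: (pullback_eq h).
Qed.

Lemma product_terminal_pullback (C : Category) (T A B P : C) (a : Hom A T) (b : Hom B T)
  (p1 : Hom P A) (p2 : Hom P B) :
  IsTerminal T -> IsProduct p1 p2 -> IsPullback a b p1 p2.
Proof.
move=> hT h; apply: pullback_intro => [|X x y _|X u v h1 h2].
- exact: terminal_eq.
- exact: (product_ex _ _ h).
- exact: (product_eq h).
Qed.

Lemma lex_product (C D : Category) (R : Functor C D) (A B P : C)
  (p1 : Hom P A) (p2 : Hom P B) :
  (exists T : C, IsTerminal T) -> PreservesFiniteLimits R ->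
  IsProduct p1 p2 -> IsProduct (fmap R p1) (fmap R p2).
Proof.
move=> [T hT] lex h; case: (hT A) => a _; case: (hT B) => b _.
apply: (terminal_pullback_product (pres_terminal lex hT)).
exact: (pres_pullback lex (product_terminal_pullback a b hT h)).
Qed.

Lemma exponential_transpose (C : Category) (A B X P : C)
  (p1 : Hom P X) (p2 : Hom P A) (ev : Hom P B) (Y Q : C) (q1 : Hom Q Y) (q2 : Hom Q A)
  (g : Hom Q B) :
  IsExponential p1 p2 ev -> IsProduct q1 q2 ->
  exists h : Hom Y X, forall k : Hom Q P, p1 ∘ k = h ∘ q1 -> p2 ∘ k = q2 -> ev ∘ k = g.
Proof.
move=> [hP he] hQ; case: (he _ _ _ _ hQ g) => h [[k [k1 [k2 <-]]] _]; exists h => k' k1' k2'.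
by congr (_ ∘ _); apply: (product_eq hP); rewrite ?k1 ?k2.
Qed.

Lemma exponential_eq (C : Category) (A B X P : C)
  (p1 : Hom P X) (p2 : Hom P A) (ev : Hom P B) (Y Q : C) (q1 : Hom Q Y) (q2 : Hom Q A)
  (h h' : Hom Y X) (k k' : Hom Q P) :
  IsExponential p1 p2 ev -> IsProduct q1 q2 ->
  p1 ∘ k = h ∘ q1 -> p2 ∘ k = q2 -> p1 ∘ k' = h' ∘ q1 -> p2 ∘ k' = q2 ->
  ev ∘ k = ev ∘ k' -> h = h'.
Proof.
move=> [hP he] hQ k1 k2 k1' k2' e; apply: (unique_eq (he _ _ _ _ hQ (ev ∘ k))).
- by exists k.
- by exists k'.
Qed.

Definition choice (T : Type) (h : inhabited T) : T :=
  proj1_sig (constructive_indefinite_description (fun _ => True)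
    (let 'inhabits x := h in ex_intro _ x I)).

Definition one (E : Topos) : E :=
  proj1_sig (constructive_indefinite_description _ (has_terminal (topos_axioms E))).

Lemma one_terminal (E : Topos) : IsTerminal (one E).
Proof. exact: (proj2_sig (constructive_indefinite_description _ _)). Qed.

Lemma bang_inhabited (E : Topos) (X : E) : inhabited (Hom X (one E)).
Proof. by case: (one_terminal X) => u _. Qed.

Definition bang (E : Topos) (X : E) : Hom X (one E) := choice (bang_inhabited X).

Lemma bang_eq (E : Topos) (X : E) (u v : Hom X (one E)) : u = v.
Proof. exact: terminal_eq (@one_terminal E). Qed.

Record ProductOf (C : Category) (A B : C) := {
  prod_ob : C; prod_fst : Hom prod_ob A; prod_snd : Hom prod_ob B;
  prod_is : IsProduct prod_fst prod_snd }.

Lemma product_inhabited (E : Topos) (A B : E) : inhabited (ProductOf A B).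
Proof.
case: (has_pullbacks (topos_axioms E) (bang A) (bang B)) => P [p1 [p2 h]].
exact: (inhabits (Build_ProductOf (terminal_pullback_product (@one_terminal E) h))).
Qed.

Definition prd (E : Topos) (A B : E) : E := prod_ob (choice (product_inhabited A B)).
Local Notation "A × B" := (prd A B) (at level 40, left associativity).
Definition pfst (E : Topos) (A B : E) : Hom (A × B) A := prod_fst (choice (product_inhabited A B)).
Definition psnd (E : Topos) (A B : E) : Hom (A × B) B := prod_snd (choice (product_inhabited A B)).
Arguments pfst {E A B}.
Arguments psnd {E A B}.

Lemma prd_product (E : Topos) (A B : E) : IsProduct (@pfst E A B) (@psnd E A B).
Proof. exact: prod_is. Qed.

Definition ppair (E : Topos) (A B X : E) (a : Hom X A) (b : Hom X B) : Hom X (A × B) :=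
  proj1_sig (constructive_indefinite_description _ (prd_product a b)).
Local Notation "⟨ a , b ⟩" := (ppair a b) (format "⟨ a ,  b ⟩").

Lemma fst_pair (E : Topos) (A B X : E) (a : Hom X A) (b : Hom X B) : pfst ∘ ⟨a, b⟩ = a.
Proof. by rewrite /ppair; case: constructive_indefinite_description => u [[]]. Qed.

Lemma snd_pair (E : Topos) (A B X : E) (a : Hom X A) (b : Hom X B) : psnd ∘ ⟨a, b⟩ = b.
Proof. by rewrite /ppair; case: constructive_indefinite_description => u [[]]. Qed.

Lemma prd_eq (E : Topos) (A B X : E) (u v : Hom X (A × B)) :
  pfst ∘ u = pfst ∘ v -> psnd ∘ u = psnd ∘ v -> u = v.
Proof. exact: product_eq (@prd_product E A B). Qed.

Lemma pair_comp (E : Topos) (A B X Y : E) (a : Hom X A) (b : Hom X B) (u : Hom Y X) :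
  ⟨a, b⟩ ∘ u = ⟨a ∘ u, b ∘ u⟩.
Proof. by apply: prd_eq; rewrite comp_assoc ?fst_pair ?snd_pair. Qed.

Lemma pair_eta (E : Topos) (A B X : E) (u : Hom X (A × B)) : ⟨pfst ∘ u, psnd ∘ u⟩ = u.
Proof. by apply: prd_eq; rewrite ?fst_pair ?snd_pair. Qed.

Lemma pair_id (E : Topos) (A B : E) : ⟨pfst, psnd⟩ = idm (A × B).
Proof. by rewrite -(pair_eta (idm _)) !comp_idr. Qed.

Lemma pair_inj (E : Topos) (A B X : E) (a a' : Hom X A) (b b' : Hom X B) :
  ⟨a, b⟩ = ⟨a', b'⟩ -> a = a' /\ b = b'.
Proof.
by move=> e; split; [rewrite -(fst_pair a b) e fst_pair|rewrite -(snd_pair a b) e snd_pair].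
Qed.

Record ExponentialOf (E : Topos) (A B : E) := {
  exponential_ob : E; exponential_ev : Hom (exponential_ob × A) B;
  exponential_is : IsExponential pfst psnd exponential_ev }.

(** [k] is the canonical isomorphism between two products of [X] and [A]; this moves an exponential
    onto the chosen product. *)
Lemma exponential_change (C : Category) (A B X P Q : C)
  (p1 : Hom P X) (p2 : Hom P A) (ev : Hom P B) (q1 : Hom Q X) (q2 : Hom Q A) (k : Hom Q P) :
  IsExponential p1 p2 ev -> IsProduct q1 q2 -> p1 ∘ k = q1 -> p2 ∘ k = q2 ->
  IsExponential q1 q2 (ev ∘ k).
Proof.
move=> [hP he] hQ e1 e2; split=> // Y Z z1 z2 hZ g.
case: (he _ _ _ _ hZ g) => h [[k' [k1 [k2 k3]]] uh]; exists h; split.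
- have [w [w1 w2]] := product_ex (h ∘ z1) z2 hQ; exists w; split=> //; split=> //.
  rewrite -k3 -comp_assoc; congr (_ ∘ _).
  by apply: (product_eq hP); rewrite comp_assoc ?e1 ?e2 ?w1 ?w2.
- move=> h' [w [w1 [w2 w3]]]; apply: uh; exists (k ∘ w).
  by rewrite comp_assoc e1 w1 comp_assoc e2 w2 comp_assoc.
Qed.

Lemma exponential_inhabited (E : Topos) (A B : E) : inhabited (ExponentialOf A B).
Proof.
case: (has_exponentials (topos_axioms E) A B) => X [P [p1 [p2 [ev h]]]].
case: (product_ex (@pfst E X A) psnd (proj1 h)) => k [k1 k2].
exact: (inhabits (Build_ExponentialOf (exponential_change h (@prd_product E X A) k1 k2))).
Qed.

Definition exponential (E : Topos) (A B : E) : E :=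
  exponential_ob (choice (exponential_inhabited A B)).
Definition ev (E : Topos) (A B : E) : Hom (exponential A B × A) B :=
  exponential_ev (choice (exponential_inhabited A B)).
Arguments ev {E A B}.

Lemma ev_exponential (E : Topos) (A B : E) : IsExponential pfst psnd (@ev E A B).
Proof. exact: exponential_is. Qed.

Lemma curry_inhabited (E : Topos) (A B Y : E) (g : Hom (Y × A) B) :
  inhabited {h : Hom Y (exponential A B) | ev ∘ ⟨h ∘ pfst, psnd⟩ = g}.
Proof.
case: (exponential_transpose g (@ev_exponential E A B) (@prd_product E Y A)) => h hh.
by constructor; exists h; apply: hh; rewrite ?fst_pair ?snd_pair.
Qed.

Definition curry (E : Topos) (A B Y : E) (g : Hom (Y × A) B) : Hom Y (exponential A B) :=
  proj1_sig (choice (curry_inhabited g)).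

Lemma ev_curry (E : Topos) (A B Y T : E) (g : Hom (Y × A) B) (y : Hom T Y) (a : Hom T A) :
  ev ∘ ⟨curry g ∘ y, a⟩ = g ∘ ⟨y, a⟩.
Proof.
rewrite -[g in RHS](proj2_sig (choice (curry_inhabited g))) -comp_assoc pair_comp.
by rewrite -comp_assoc fst_pair snd_pair.
Qed.

Lemma curry_eq (E : Topos) (A B Y : E) (h h' : Hom Y (exponential A B)) :
  (forall (T : E) (y : Hom T Y) (a : Hom T A), ev ∘ ⟨h ∘ y, a⟩ = ev ∘ ⟨h' ∘ y, a⟩) -> h = h'.
Proof.
move=> e; apply: (exponential_eq (@ev_exponential E A B) (@prd_product E Y A) _ _ _ _
  (e _ pfst psnd)); by rewrite ?fst_pair ?snd_pair.
Qed.

(** * Generalized elements and truth values *)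

(** The classifier recast in generalized elements: [truth_tt X] is the value true at stage [X], and
    a classifying map is described by the elements that factor through the subobject, so that no
    terminal object or pullback square occurs. *)
Record TruthObject (E : Topos) := {
  truth_ob : E;
  truth_tt : forall X, Hom X truth_ob;
  truth_tt_comp : forall X Y (u : Hom X Y), truth_tt Y ∘ u = truth_tt X;
  truth_chi : forall (A X : E) (m : Hom A X), IsMono m ->
    exists ! chi : Hom X truth_ob, forall (T : E) (t : Hom T X),
      chi ∘ t = truth_tt T <-> exists s, m ∘ s = t }.

Lemma truth_inhabited (E : Topos) : inhabited (TruthObject E).
Proof.
case: (has_classifier (topos_axioms E)) => T0 [O [t [hT ht]]].
have b X : inhabited (Hom X T0) by case: (hT X).
constructor; refine (@Build_TruthObject E O (fun X => t ∘ choice (b X)) _ _).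
- by move=> X Y u; rewrite -comp_assoc; congr (_ ∘ _); apply: terminal_eq.
- move=> A X m hm.
  have eqv (chi : Hom X O) : (exists bang : Hom A T0, IsPullback chi t m bang) <->
    (forall (T : E) (t' : Hom T X), chi ∘ t' = t ∘ choice (b T) <-> exists s, m ∘ s = t').
    split.
    + move=> [bg pb] T x; split.
      * by move=> /(pullback_ex pb) [s [hs _]]; exists s.
      * move=> [s <-]; rewrite comp_assoc (pullback_comm pb) -comp_assoc.
        by congr (_ ∘ _); apply: terminal_eq.
    + move=> h; exists (choice (b A)); apply: pullback_intro.
      * by apply/h; exists (idm A); rewrite comp_idr.
      * move=> Y x y e; have : chi ∘ x = t ∘ choice (b Y).
          by rewrite e; congr (_ ∘ _); apply: terminal_eq.
        by move=> /h [s hs]; exists s; split=> //; apply: terminal_eq.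
      * by move=> Y u v e _; apply: hm.
  case: (ht A X m hm) => chi [h u]; exists chi; split; first by apply/eqv.
  by move=> chi' /eqv; apply: u.
Qed.

Definition Om (E : Topos) : E := truth_ob (choice (truth_inhabited E)).
Definition truth (E : Topos) (X : E) : Hom X (Om E) := truth_tt (choice (truth_inhabited E)) X.
Definition holds (E : Topos) (T : E) (p : Hom T (Om E)) : Prop := p = truth T.

Lemma tt_comp (E : Topos) (X Y : E) (u : Hom X Y) : truth Y ∘ u = truth X.
Proof. exact: truth_tt_comp. Qed.

Lemma holds_comp (E : Topos) (T T' : E) (p : Hom T (Om E)) (r : Hom T' T) :
  holds p -> holds (p ∘ r).
Proof. by move=> ->; apply: tt_comp. Qed.

(** An equalizer is the intersection of two graphs. The pullback square stays in the statement
    because lex functors preserve it; [lex_equalizer] relies on that. *)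
Lemma equalizer_ex (E : Topos) (A B : E) (a b : Hom A B) :
  exists (K : E) (e : Hom K A),
    [/\ IsMono e, IsPullback ⟨idm A, a⟩ ⟨idm A, b⟩ e e &
    forall (T : E) (t : Hom T A), a ∘ t = b ∘ t <-> exists s, e ∘ s = t].
Proof.
case: (has_pullbacks (topos_axioms E) ⟨idm A, a⟩ ⟨idm A, b⟩) => K [e [e' h]].
have := pullback_comm h; rewrite !pair_comp !comp_idl => /pair_inj [? hab]; subst e'.
exists K, e; split=> //.
- by move=> W u v huv; apply: (pullback_eq h).
- move=> T t; split=> [ht|[s <-]].
  + have [|s [hs _]] := @pullback_ex _ _ _ _ _ _ _ _ _ _ t t h; last by exists s.
    by rewrite !pair_comp ht.
  + by rewrite !comp_assoc hab.
Qed.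

Lemma chi_ex (E : Topos) (A X : E) (m : Hom A X) : IsMono m ->
  exists chi : Hom X (Om E), forall (T : E) (t : Hom T X),
    holds (chi ∘ t) <-> exists s, m ∘ s = t.
Proof. by move=> /(truth_chi (choice (truth_inhabited E))) [chi [h _]]; exists chi. Qed.

Lemma sub_ex (E : Topos) (Z : E) (chi : Hom Z (Om E)) :
  exists (K : E) (m : Hom K Z), IsMono m /\
    forall (T : E) (t : Hom T Z), holds (chi ∘ t) <-> exists s, m ∘ s = t.
Proof.
case: (equalizer_ex chi (truth Z)) => K [m [hm _ h]]; exists K, m; split=> // T t.
by rewrite -h tt_comp.
Qed.

Lemma omega_ext (E : Topos) (Z : E) (chi chi' : Hom Z (Om E)) :
  (forall (T : E) (t : Hom T Z), holds (chi ∘ t) <-> holds (chi' ∘ t)) -> chi = chi'.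
Proof.
move=> h; case: (sub_ex chi) => K [m [hm hK]].
apply: (unique_eq (truth_chi (choice (truth_inhabited E)) hm)).
- exact: hK.
- by move=> T t; rewrite -hK h.
Qed.

(** Represented predicates play the part of formulas of the internal language; the lemmas below
    supply the Kripke-Joyal clauses. *)
Definition Rep (E : Topos) (Z : E) (phi : forall T : E, Hom T Z -> Prop) : Prop :=
  exists chi : Hom Z (Om E), forall (T : E) (t : Hom T Z), holds (chi ∘ t) <-> phi T t.

Lemma rep_sub (E : Topos) (Z : E) (phi : forall T : E, Hom T Z -> Prop) : Rep phi ->
  exists (K : E) (m : Hom K Z), IsMono m /\
    forall (T : E) (t : Hom T Z), phi T t <-> exists s, m ∘ s = t.
Proof.
move=> [chi h]; case: (sub_ex chi) => K [m [hm hK]]; exists K, m; split=> // T t.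
by rewrite -h hK.
Qed.

Lemma rep_holds (E : Topos) (Z : E) (chi : Hom Z (Om E)) :
  Rep (fun (T : E) (t : Hom T Z) => holds (chi ∘ t)).
Proof. by exists chi. Qed.

Lemma rep_ext (E : Topos) (Z : E) (phi psi : forall T : E, Hom T Z -> Prop) :
  (forall T t, phi T t <-> psi T t) -> Rep phi -> Rep psi.
Proof. by move=> h [chi hc]; exists chi => T t; rewrite hc. Qed.

Lemma rep_pull (E : Topos) (Z Z' : E) (f : Hom Z' Z) (phi : forall T : E, Hom T Z -> Prop) :
  Rep phi -> Rep (fun (T : E) (t : Hom T Z') => phi T (f ∘ t)).
Proof. by move=> [chi h]; exists (chi ∘ f) => T t; rewrite -comp_assoc. Qed.

Lemma rep_mono (E : Topos) (A Z : E) (m : Hom A Z) :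
  IsMono m -> Rep (fun (T : E) (t : Hom T Z) => exists s, m ∘ s = t).
Proof. exact: chi_ex. Qed.

Lemma rep_eq (E : Topos) (Z B : E) (a b : Hom Z B) :
  Rep (fun (T : E) (t : Hom T Z) => a ∘ t = b ∘ t).
Proof.
case: (equalizer_ex a b) => K [m [hm _ h]]; case: (chi_ex hm) => chi hc.
by exists chi => T t; rewrite hc h.
Qed.

Lemma rep_and (E : Topos) (Z : E) (phi psi : forall T : E, Hom T Z -> Prop) :
  Rep phi -> Rep psi -> Rep (fun (T : E) (t : Hom T Z) => phi T t /\ psi T t).
Proof.
move=> [chi h] [chi' h'].
apply: rep_ext (rep_eq ⟨chi, chi'⟩ ⟨truth Z, truth Z⟩) => T t.
rewrite -h -h' !pair_comp !tt_comp; split; first by move=> /pair_inj.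
by move=> [-> ->].
Qed.

(** An implication is true exactly when its premise equals the meet of premise and conclusion, hence
    the equation between [chi] and [chi2]. *)
Lemma rep_imp (E : Topos) (Z : E) (phi psi : forall T : E, Hom T Z -> Prop) :
  Rep phi -> Rep psi ->
  Rep (fun (T : E) (t : Hom T Z) => forall (T' : E) (r : Hom T' T),
    phi T' (t ∘ r) -> psi T' (t ∘ r)).
Proof.
move=> hphi hpsi; case: (rep_and hphi hpsi) => chi2 h2; case: hphi hpsi => chi h [chi' h'].
apply: rep_ext (rep_eq chi chi2) => T t; split=> [e T' r|hi].
- by rewrite -h comp_assoc e -comp_assoc h2 => -[].
- apply: omega_ext => T' r; rewrite -!comp_assoc h h2.
  by split=> [hp|[]//]; split=> //; apply: hi.
Qed.

(** Quantification is an equation in an exponential: the curried predicate agrees with the curried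
    constant true. *)
Lemma rep_all (E : Topos) (Z Y : E) (phi : forall T : E, Hom T (Z × Y) -> Prop) :
  Rep phi ->
  Rep (fun (T : E) (t : Hom T Z) => forall (T' : E) (r : Hom T' T) (y : Hom T' Y),
    phi T' ⟨t ∘ r, y⟩).
Proof.
move=> [chi h]; apply: rep_ext (rep_eq (curry chi) (curry (truth _))) => T t; split.
- by move=> e T' r y; rewrite -h /holds -ev_curry comp_assoc e -comp_assoc ev_curry tt_comp.
- move=> ha; apply: curry_eq => T' r y; rewrite -!comp_assoc !ev_curry tt_comp.
  exact/h/ha.
Qed.

Lemma rep_all_imp (E : Topos) (Z Y : E) (phi psi : forall T : E, Hom T (Z × Y) -> Prop) :
  Rep phi -> Rep psi ->
  Rep (fun (T : E) (t : Hom T Z) => forall (T' : E) (r : Hom T' T) (y : Hom T' Y),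
    phi T' ⟨t ∘ r, y⟩ -> psi T' ⟨t ∘ r, y⟩).
Proof.
move=> h h'; apply: rep_ext (rep_all (rep_imp h h')) => T t; split.
- by move=> ha T' r y; move: (ha T' r y T' (idm T')); rewrite comp_idr.
- by move=> ha T' r y T'' r'; rewrite pair_comp -comp_assoc; apply: ha.
Qed.

(** * Power objects and singletons *)

Definition Pow (E : Topos) (X : E) : E := exponential X (Om E).

Definition mem (E : Topos) (X T : E) (S : Hom T (Pow X)) (x : Hom T X) : Prop :=
  holds (ev ∘ ⟨S, x⟩).

Lemma pow_ext (E : Topos) (X Z : E) (S S' : Hom Z (Pow X)) :
  (forall (T : E) (z : Hom T Z) (x : Hom T X), mem (S ∘ z) x <-> mem (S' ∘ z) x) -> S = S'.
Proof.
move=> h; apply: curry_eq => T z x; apply: omega_ext => T' r.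
by rewrite -!comp_assoc !pair_comp -!comp_assoc; apply: h.
Qed.

Lemma pow_compr (E : Topos) (X Z : E) (phi : forall T : E, Hom T (Z × X) -> Prop) : Rep phi ->
  exists S : Hom Z (Pow X), forall (T : E) (z : Hom T Z) (x : Hom T X),
    mem (S ∘ z) x <-> phi T ⟨z, x⟩.
Proof. by move=> [chi h]; exists (curry chi) => T z x; rewrite /mem ev_curry. Qed.

Lemma singleton_ex (E : Topos) (X : E) :
  exists sg : Hom X (Pow X), IsMono sg /\
    forall (T : E) (x y : Hom T X), mem (sg ∘ x) y <-> x = y.
Proof.
case: (pow_compr (rep_eq (@pfst E X X) psnd)) => sg h.
have h' (T : E) (x y : Hom T X) : mem (sg ∘ x) y <-> x = y.
  by rewrite h fst_pair snd_pair.
by exists sg; split=> // W u v e; apply/h'; rewrite e; apply/h'.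
Qed.

(** * Left adjoints of cartesian closed lex functors *)

Lemma lex_prd (C : Topos) (B : Category) (R : Functor C B) (h : PreservesFiniteLimits R)
  (X Y : C) : IsProduct (fmap R (@pfst C X Y)) (fmap R (@psnd C X Y)).
Proof.
apply: lex_product h (@prd_product C X Y); exists (one C); exact: one_terminal.
Qed.

Definition rpair (C : Topos) (B : Category) (R : Functor C B) (h : PreservesFiniteLimits R)
  (X Y : C) (T : B) (a : Hom T (R X)) (b : Hom T (R Y)) : Hom T (R (X × Y)) :=
  proj1_sig (constructive_indefinite_description _ (lex_prd h a b)).

Lemma rpair_spec (C : Topos) (B : Category) (R : Functor C B) (h : PreservesFiniteLimits R)
  (X Y : C) (T : B) (a : Hom T (R X)) (b : Hom T (R Y)) :
  fmap R pfst ∘ rpair h a b = a /\ fmap R psnd ∘ rpair h a b = b.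
Proof. by rewrite /rpair; case: constructive_indefinite_description => u []. Qed.

Lemma rpair_eq (C : Topos) (B : Category) (R : Functor C B) (h : PreservesFiniteLimits R)
  (X Y : C) (T : B) (u v : Hom T (R (X × Y))) :
  fmap R pfst ∘ u = fmap R pfst ∘ v -> fmap R psnd ∘ u = fmap R psnd ∘ v -> u = v.
Proof. exact: product_eq (lex_prd h (X:=X) (Y:=Y)). Qed.

Lemma rpair_comp (C : Topos) (B : Category) (R : Functor C B) (h : PreservesFiniteLimits R)
  (X Y : C) (T T' : B) (a : Hom T (R X)) (b : Hom T (R Y)) (u : Hom T' T) :
  rpair h a b ∘ u = rpair h (a ∘ u) (b ∘ u).
Proof.
case: (rpair_spec h a b) => h1 h2; case: (rpair_spec h (a ∘ u) (b ∘ u)) => h3 h4.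
by apply: (rpair_eq h); rewrite ?h3 ?h4 comp_assoc ?h1 ?h2.
Qed.

Lemma fmap_pair (C : Topos) (B : Category) (R : Functor C B) (h : PreservesFiniteLimits R)
  (X Y Z : C) (T : B) (a : Hom Z X) (b : Hom Z Y) (u : Hom T (R Z)) :
  fmap R ⟨a, b⟩ ∘ u = rpair h (fmap R a ∘ u) (fmap R b ∘ u).
Proof.
case: (rpair_spec h (fmap R a ∘ u) (fmap R b ∘ u)) => h1 h2.
by apply: (rpair_eq h); rewrite ?h1 ?h2 comp_assoc -fmap_comp ?fst_pair ?snd_pair.
Qed.

Lemma fmap_ev_pair (C : Topos) (B : Category) (R : Functor C B) (h : PreservesFiniteLimits R)
  (X Y Z O : C) (T : B) (g : Hom (X × Y) O) (a : Hom Z X) (b : Hom Z Y) (u : Hom T (R Z)) :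
  fmap R (g ∘ ⟨a, b⟩) ∘ u = fmap R g ∘ rpair h (fmap R a ∘ u) (fmap R b ∘ u).
Proof. by rewrite fmap_comp -comp_assoc (fmap_pair h). Qed.

Lemma fmap_curry (C : Topos) (B : Category) (R : Functor C B) (h : PreservesFiniteLimits R)
  (X Y O : C) (T : B) (g : Hom (Y × X) O) (a : Hom T (R Y)) (b : Hom T (R X)) :
  fmap R ev ∘ rpair h (fmap R (curry g) ∘ a) b = fmap R g ∘ rpair h a b.
Proof.
have := ev_curry g (@pfst C Y X) psnd; rewrite pair_id comp_idr => e.
case: (rpair_spec h a b) => h1 h2.
by rewrite -[in RHS]e (fmap_ev_pair h) fmap_comp -comp_assoc h1 h2.
Qed.

(** Preservation of exponentials makes [R (exponential X O)] an exponential of [R O] by [R X]; this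
    is its currying at arbitrary stages, and [rcurry_eq] its extensionality. *)
Lemma rcurry_ex (C B : Topos) (R : Functor C B) (h : PreservesFiniteLimits R)
  (X O : C) (Y : B) (g : Hom (Y × R X) (R O)) : PreservesExponentials R ->
  exists u : Hom Y (R (exponential X O)), forall (T : B) (y : Hom T Y) (x : Hom T (R X)),
    fmap R ev ∘ rpair h (u ∘ y) x = g ∘ ⟨y, x⟩.
Proof.
move=> hx; have he := hx _ _ _ _ _ _ _ (@ev_exponential C X O).
case: (exponential_transpose g he (@prd_product B Y (R X))) => u hu; exists u => T y x.
case: (rpair_spec h (u ∘ pfst) (@psnd B Y (R X))) => h1 h2.
rewrite -(hu _ h1 h2) -comp_assoc rpair_comp -comp_assoc fst_pair snd_pair //.
Qed.

Lemma rcurry_eq (C B : Topos) (R : Functor C B) (h : PreservesFiniteLimits R)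
  (X O : C) (Y : B) (u v : Hom Y (R (exponential X O))) : PreservesExponentials R ->
  (forall (T : B) (y : Hom T Y) (x : Hom T (R X)),
    fmap R ev ∘ rpair h (u ∘ y) x = fmap R ev ∘ rpair h (v ∘ y) x) -> u = v.
Proof.
move=> hx; have he := hx _ _ _ _ _ _ _ (@ev_exponential C X O); move=> e.
case: (rpair_spec h (u ∘ pfst) (@psnd B Y (R X))) => h1 h2.
case: (rpair_spec h (v ∘ pfst) (@psnd B Y (R X))) => h3 h4.
exact: (exponential_eq he (@prd_product B Y (R X)) h1 h2 h3 h4 (e _ _ _)).
Qed.

(** Both sides factor through [R] of the terminal object, which is terminal. *)
Lemma fmap_tt_eq (C : Topos) (B : Category) (R : Functor C B) (h : PreservesFiniteLimits R)
  (T T' : C) (X : B) (r : Hom X (R T)) (r' : Hom X (R T')) :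
  fmap R (truth T) ∘ r = fmap R (truth T') ∘ r'.
Proof.
rewrite -(tt_comp (bang T)) -(tt_comp (bang T')) !fmap_comp -!comp_assoc; congr (_ ∘ _).
by apply: terminal_eq; apply: (pres_terminal h); apply: one_terminal.
Qed.

Lemma lex_equalizer (C : Topos) (B : Category) (R : Functor C B) (h : PreservesFiniteLimits R)
  (X Y K : C) (a b : Hom X Y) (e : Hom K X) (T : B) (t : Hom T (R X)) :
  IsPullback ⟨idm X, a⟩ ⟨idm X, b⟩ e e ->
  fmap R a ∘ t = fmap R b ∘ t -> exists s, fmap R e ∘ s = t.
Proof.
move=> /(pres_pullback h) pb eab.
have [|s [hs _]] := @pullback_ex _ _ _ _ _ _ _ _ _ _ t t pb; last by exists s.
by rewrite !(fmap_pair h) eab.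
Qed.

(** A map is monic exactly when its kernel pair is trivial, which is a pullback condition. *)
Lemma lex_mono (C B : Category) (R : Functor C B) (X Y : C) (m : Hom X Y) :
  PreservesFiniteLimits R -> IsMono m -> IsMono (fmap R m).
Proof.
move=> h hm; have pb : IsPullback m m (idm X) (idm X).
  apply: pullback_intro => // [W x y|W u v]; last by rewrite !comp_idl.
  by move=> /hm <-; exists x; rewrite comp_idl.
move=> W u v e; case: (pullback_ex (pres_pullback h pb) e) => w.
by rewrite fmap_id !comp_idl => -[-> ->].
Qed.

(** [W = Om ^ A] is weakly universal for [Z] with respect to powers, and [I]
    internalizes the subobjects of [W] through whose image under [R] the map
    [Z -> R W] factors.  As [R] preserves exponentials, it preserves the
    internal intersection [Z0] of all members of [I], so that [Z0] is the least
    such subobject. *)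
Lemma exponential_universal_exists (C B : Topos) (R : Functor C B) :
  PreservesFiniteLimits R -> PreservesExponentials R ->
  (forall (O : C) (Z : B), exists (A : C) (eps : Hom (R A × Z) (R O)),
     forall (T : C) (g : Hom (R T × Z) (R O)),
       exists ! t : Hom T A, eps ∘ ⟨fmap R t ∘ pfst, psnd⟩ = g) ->
  forall Z : B, exists (L : C) (eta : Hom Z (R L)), IsUniversal eta.
Proof.
move=> h hx hrep Z; case: (hrep (Om C) Z) => A [eps heps].
have aex (T : C) (g : Hom (R T × Z) (R (Om C))) : exists t : Hom T A,
  forall (X : B) (r : Hom X (R T)) (z : Hom X Z), eps ∘ ⟨fmap R t ∘ r, z⟩ = g ∘ ⟨r, z⟩.
  case: (heps T g) => t [<- _]; exists t => X r z.
  by rewrite -comp_assoc pair_comp -comp_assoc fst_pair snd_pair.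
have aeq (T : C) (t t' : Hom T A) :
  (forall (X : B) (r : Hom X (R T)) (z : Hom X Z),
     eps ∘ ⟨fmap R t ∘ r, z⟩ = eps ∘ ⟨fmap R t' ∘ r, z⟩) -> t = t'.
  by move=> e; apply: (unique_eq (heps T (eps ∘ ⟨fmap R t' ∘ pfst, psnd⟩))).
pose W := Pow A.
(* [A] is an object of codes for functions on [Z] with values in [R (Om C)], and [ev0] sends [z] to
   evaluation of codes at [z]. *)
case: (rcurry_ex h (eps ∘ ⟨psnd, pfst⟩) hx) => ev0 hev0.
have {}hev0 (T : B) (z : Hom T Z) (a : Hom T (R A)) :
  fmap R ev ∘ rpair h (ev0 ∘ z) a = eps ∘ ⟨a, z⟩.
  by rewrite hev0 -comp_assoc pair_comp snd_pair fst_pair.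
(* [th] takes a subobject of [W] to the code of the predicate on [Z] that [ev0] lands in it, and
   [tau] is constantly the code of true. Their equalizer [J] thus consists of the subobjects through
   which [ev0] factors. *)
case: (aex (Pow W) (fmap R ev ∘ rpair h pfst (ev0 ∘ psnd))) => th hth.
have {}hth (X : B) (r : Hom X (R (Pow W))) (z : Hom X Z) :
  eps ∘ ⟨fmap R th ∘ r, z⟩ = fmap R ev ∘ rpair h r (ev0 ∘ z).
  by rewrite hth -comp_assoc rpair_comp -comp_assoc fst_pair snd_pair.
case: (aex (Pow W) (fmap R (truth _) ∘ pfst)) => tau htau.
have {}htau (X : B) (r : Hom X (R (Pow W))) (z : Hom X Z) :
  eps ∘ ⟨fmap R tau ∘ r, z⟩ = fmap R (truth _) ∘ r.
  by rewrite htau -comp_assoc fst_pair.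
case: (equalizer_ex th tau) => J [i [_ _ hi]].
have hJ : th ∘ i = tau ∘ i by apply/hi; exists (idm J); rewrite comp_idr.
(* [ka w] is the set of members of [J] that contain [w], and [kt w] is all of [J]. Their equalizer
   [Z0] is the intersection of the members of [J], cut out by an equation that [R] preserves. *)
pose ka : Hom W (Pow J) := curry (ev ∘ ⟨i ∘ psnd, pfst⟩).
pose kt : Hom W (Pow J) := curry (truth (W × J)).
have hka (T : C) (w : Hom T W) (j : Hom T J) : ev ∘ ⟨ka ∘ w, j⟩ = ev ∘ ⟨i ∘ j, w⟩.
  by rewrite ev_curry -comp_assoc pair_comp -comp_assoc fst_pair snd_pair.
case: (equalizer_ex ka kt) => Z0 [z0 [hz0 pbz0 hz0']].
have [|eta heta] := lex_equalizer (t := ev0) h pbz0.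
  apply (@rcurry_eq _ _ _ h J (Om C) _ _ _ hx) => T z j.
  rewrite -!comp_assoc !fmap_curry fmap_ev_pair fmap_comp.
  case: (rpair_spec h (ev0 ∘ z) j) => e1 e2; rewrite -!comp_assoc e1 e2 -hth.
  by rewrite comp_assoc -fmap_comp hJ fmap_comp -comp_assoc htau; apply: fmap_tt_eq.
(* A subobject through which [ev0] factors gives, as the constant family [S], an element of [J];
   hence it contains the intersection. *)
have minimal (N : C) (n : Hom N W) (e' : Hom Z (R N)) :
  IsMono n -> fmap R n ∘ e' = ev0 -> exists j : Hom Z0 N, n ∘ j = z0.
  move=> /chi_ex [chi hchi] he'; pose S : Hom Z0 (Pow W) := curry (chi ∘ psnd).
  have [|s hs] := proj1 (hi _ S).
    apply: aeq => X r z; rewrite !fmap_comp -!comp_assoc hth htau fmap_curry fmap_comp.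
    case: (rpair_spec h r (ev0 ∘ z)) => _; rewrite -comp_assoc => ->.
    have hn : holds (chi ∘ n) by apply/hchi; exists (idm N); rewrite comp_idr.
    by rewrite -he' -(comp_assoc (fmap R n)) comp_assoc -fmap_comp hn; apply: fmap_tt_eq.
  apply/hchi; have <- : ev ∘ ⟨i ∘ s, z0⟩ = chi ∘ z0.
    by rewrite hs -(comp_idr S) ev_curry -comp_assoc snd_pair.
  have hk : ka ∘ z0 = kt ∘ z0 by apply/hz0'; exists (idm _); rewrite comp_idr.
  by rewrite -hka hk ev_curry; apply: tt_comp.
exists Z0, eta => X x.
case: (singleton_ex X) => sg [hsg1 hsg2].
(* [un] embeds [X] in its double power object, sending [y] to the set of subobjects that contain it;
   singletons separate the values. *)
pose un : Hom X (Pow (Pow X)) := curry (ev ∘ ⟨psnd, pfst⟩).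
have hun (T : C) (y : Hom T X) (S : Hom T (Pow X)) : ev ∘ ⟨un ∘ y, S⟩ = ev ∘ ⟨S, y⟩.
  by rewrite ev_curry -comp_assoc pair_comp fst_pair snd_pair.
have mun : IsMono un.
  move=> T u v e; apply/hsg2/esym; apply: eq_trans (_ : ev ∘ ⟨sg ∘ u, u⟩ = _).
    by apply/esym/hsg2.
  by rewrite -!hun e.
(* [xt] takes a subobject of [X] to the code of its preimage under [x], so that
   [fmap R px ∘ ev0 = fmap R un ∘ x]. The pullback [N] is then a subobject of [W] that maps to [X]
   and through which [ev0] factors. *)
case: (aex (Pow X) (fmap R ev ∘ rpair h pfst (x ∘ psnd))) => xt hxt.
pose px : Hom W (Pow (Pow X)) := curry (ev ∘ ⟨pfst, xt ∘ psnd⟩).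
case: (has_pullbacks (topos_axioms C) px un) => N [n [q pbN]].
have [|e' [he1 he2]] := @pullback_ex _ _ _ _ _ _ _ _ _ _ ev0 x (pres_pullback h pbN).
  apply (@rcurry_eq _ _ _ h (Pow X) (Om C) _ _ _ hx) => T z S.
  rewrite -!comp_assoc !fmap_curry !fmap_ev_pair !fmap_comp.
  case: (rpair_spec h (ev0 ∘ z) S) => e1 e2; case: (rpair_spec h (x ∘ z) S) => e3 e4.
  rewrite -comp_assoc e1 e2 e3 e4 hev0 hxt -comp_assoc rpair_comp -comp_assoc.
  by rewrite fst_pair snd_pair.
have mn : IsMono n.
  move=> T u v e; apply: (pullback_eq pbN) => //; apply: mun.
  by rewrite !comp_assoc -(pullback_comm pbN) -!comp_assoc e.
case: (minimal _ _ _ mn he1) => j hj.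
apply: (@ex_unique _ _ (q ∘ j)).
- rewrite fmap_comp -comp_assoc -he2; congr (_ ∘ _); apply: (lex_mono h mn).
  by rewrite he1 comp_assoc -fmap_comp hj.
(* Uniqueness: the equalizer of two candidates is again a subobject of [W] through which [ev0]
   factors, so it contains [Z0]. *)
- move=> y hy; case: (equalizer_ex (q ∘ j) y) => K [k [mk pbk hk]].
  have [|k' hk'] := lex_equalizer (t := eta) h pbk.
    rewrite hy fmap_comp -comp_assoc -he2; congr (_ ∘ _); apply: (lex_mono h mn).
    by rewrite he1 comp_assoc -fmap_comp hj.
  have [||l hl] := minimal K (z0 ∘ k) k'.
  + by move=> T u v; rewrite -!comp_assoc => /hz0 /mk.
  + by rewrite fmap_comp -comp_assoc hk'.
  have kl : k ∘ l = idm Z0 by apply: hz0; rewrite comp_assoc hl comp_idr.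
  rewrite -(comp_idr (q ∘ j)) -(comp_idr y); apply/hk; by exists l.
Qed.

Lemma inverse_image_universal_exists (F E : Topos) (g : GeomMor F E) :
  PreservesExponentials (inv g) ->
  forall X : F, exists (L : E) (eta : Hom X (inv g L)), IsUniversal eta.
Proof.
move=> hx; apply: exponential_universal_exists (inv_lex g) hx _ => O Z.
pose a := inv_dir g.
exists (dir g (exponential Z (inv g O))), (ev ∘ ⟨adj_counit a _ ∘ pfst, psnd⟩) => T f.
have step (t : Hom T (dir g (exponential Z (inv g O)))) :
  ev ∘ ⟨adj_counit a _ ∘ pfst, psnd⟩ ∘ ⟨fmap (inv g) t ∘ pfst, psnd⟩ =
  ev ∘ ⟨(adj_counit a _ ∘ fmap (inv g) t) ∘ pfst, psnd⟩.
  by rewrite -comp_assoc pair_comp -comp_assoc fst_pair snd_pair comp_assoc.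
case: (counit_couniversal a _ _ (curry f)) => t [ht ut]; apply: (@ex_unique _ _ t).
- by rewrite step ht ev_curry pair_id comp_idr.
- move=> t'; rewrite step => ht'; apply: ut; apply: curry_eq => X y z.
  rewrite ev_curry -ht' -[RHS]comp_assoc pair_comp -!comp_assoc fst_pair snd_pair //.
Qed.

(** Maps from [Q] to [Y] correspond to maps from [L] to the exponential of [Y] by [A], by
    universality to maps from [X] to its inverse image, and, that image being an exponential, to
    maps from [P] to [inv g Y]. *)
Lemma universal_product (F E : Topos) (g : GeomMor F E) (X : F) (L : E)
  (eta : Hom X (inv g L)) (A Q : E) (l1 : Hom Q L) (l2 : Hom Q A)
  (P : F) (x1 : Hom P X) (x2 : Hom P (inv g A)) (n : Hom P (inv g Q)) :
  PreservesExponentials (inv g) -> IsUniversal eta ->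
  IsProduct l1 l2 -> IsProduct x1 x2 ->
  fmap (inv g) l1 ∘ n = eta ∘ x1 -> fmap (inv g) l2 ∘ n = x2 -> IsUniversal n.
Proof.
move=> hx ueta hQ hP n1 n2 Y x.
have h := inv_lex g; have hge := hx _ _ _ _ _ _ _ (@ev_exponential E A Y).
have gev (c : Hom L (exponential A Y)) : fmap (inv g) (ev ∘ ⟨c ∘ l1, l2⟩) ∘ n =
  fmap (inv g) ev ∘ rpair h ((fmap (inv g) c ∘ eta) ∘ x1) x2.
  by rewrite (fmap_ev_pair h) fmap_comp -comp_assoc n1 n2 comp_assoc.
have evc (y : Hom Q Y) : exists c, y = ev ∘ ⟨c ∘ l1, l2⟩.
  case: (exponential_transpose y (@ev_exponential E A Y) hQ) => c hc; exists c.
  by rewrite hc ?fst_pair ?snd_pair.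
case: (exponential_transpose x hge hP) => w hw.
case: (ueta _ w) => c [hc _]; apply: (@ex_unique _ _ (ev ∘ ⟨c ∘ l1, l2⟩)).
- by rewrite gev hc; case: (rpair_spec h (w ∘ x1) x2) => e1 e2; apply: hw.
- move=> y'; case: (evc y') => c' ->; rewrite gev => hc'; congr (_ ∘ ⟨_ ∘ _, _⟩).
  apply: (universal_eq ueta); rewrite hc.
  case: (rpair_spec h (w ∘ x1) x2) => e1 e2.
  case: (rpair_spec h ((fmap (inv g) c' ∘ eta) ∘ x1) x2) => e3 e4.
  apply: (exponential_eq hge hP e1 e2 e3 e4).
  by rewrite hc'; apply: hw.
Qed.

(** * Slices *)

Definition slice_mk (C : Category) (A X : C) (x : Hom X A) : Slice A := existT _ X x.
Definition slice_hom_mk (C : Category) (A : C) (X Y : Slice A)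
  (u : Hom (projT1 X) (projT1 Y)) (h : projT2 Y ∘ u = projT2 X) : Hom X Y := exist _ u h.
Arguments slice_hom_mk {C A} X Y {u} h.

Definition slice_functor (C D : Category) (R : Functor C D) (A : C) :
  Functor (Slice A) (Slice (R A)).
Proof.
refine (@Build_Functor (Slice A) (Slice (R A))
  (fun X => slice_mk (fmap R (projT2 X)))
  (fun X Y u => @slice_hom_mk D (R A) (slice_mk (fmap R (projT2 X)))
     (slice_mk (fmap R (projT2 Y))) (fmap R (proj1_sig u)) _) _ _).
- by move=> X; apply: slice_hom_eq; rewrite /= fmap_id.
- by move=> X Y Z v u; apply: slice_hom_eq; rewrite /= fmap_comp.
Unshelve.
by rewrite /= -fmap_comp (proj2_sig u).
Defined.

(** The map found in the ambient category lies over [A], because both candidates for the structure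
    map of [L] agree after composition with the universal arrow. *)
Lemma slice_universal (C D : Category) (R : Functor C D) (A : C) (X : Slice (R A)) (L : Slice A)
  (eta : Hom X (slice_functor R A L)) :
  IsUniversal (R := R) (L := projT1 L) (proj1_sig eta) -> IsUniversal eta.
Proof.
move=> h Y x; case: (h _ (proj1_sig x)) => y [hy uy].
have hy' : projT2 Y ∘ y = projT2 L.
  apply: (universal_eq h); rewrite fmap_comp -comp_assoc hy (proj2_sig x).
  exact: (esym (proj2_sig eta)).
exists (slice_hom_mk L Y hy'); split.
- exact: slice_hom_eq.
- move=> y' e; apply: slice_hom_eq => /=; apply: uy.
  exact: (f_equal (@proj1_sig _ _) e).
Qed.

Lemma slice_pullback (C : Category) (D : C) (A B X P : Slice D) (a : Hom A X) (b : Hom B X)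
  (p1 : Hom P A) (p2 : Hom P B) :
  IsPullback a b p1 p2 <->
  IsPullback (proj1_sig a) (proj1_sig b) (proj1_sig p1) (proj1_sig p2).
Proof.
split=> h.
- apply: pullback_intro => [|T x y e|T u v e1 e2].
  + exact: (f_equal (@proj1_sig _ _) (pullback_comm h)).
  + pose T' := slice_mk (projT2 A ∘ x).
    have hx : projT2 A ∘ x = projT2 T' by [].
    have hy : projT2 B ∘ y = projT2 T'.
      by rewrite -(proj2_sig b) -comp_assoc -e comp_assoc (proj2_sig a).
    have [|u [hu1 hu2]] := @pullback_ex _ _ _ _ _ _ _ _ _ _
      (slice_hom_mk T' A hx) (slice_hom_mk T' B hy) h.
      exact: slice_hom_eq.
    exists (proj1_sig u); split.
    * exact: (f_equal (@proj1_sig _ _) hu1).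
    * exact: (f_equal (@proj1_sig _ _) hu2).
  + have hu : projT2 P ∘ u = projT2 (slice_mk (projT2 P ∘ u)) by [].
    have hv : projT2 P ∘ v = projT2 (slice_mk (projT2 P ∘ u)).
      by rewrite /= -(proj2_sig p1) -!comp_assoc e1.
    have := @pullback_eq _ _ _ _ _ _ _ _ _ _
      (slice_hom_mk (slice_mk _) P hu) (slice_hom_mk (slice_mk _) P hv) h.
    by move=> h'; apply: (f_equal (@proj1_sig _ _) (h' _ _)); apply: slice_hom_eq.
- apply: pullback_intro => [|T x y e|T u v e1 e2].
  + apply: slice_hom_eq; exact: (pullback_comm h).
  + case: (pullback_ex h (f_equal (@proj1_sig _ _) e)) => u [hu1 hu2].
    have hu : projT2 P ∘ u = projT2 T.
      by rewrite -(proj2_sig p1) -comp_assoc hu1 (proj2_sig x).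
    by exists (slice_hom_mk T P hu); split; apply: slice_hom_eq.
  + apply: slice_hom_eq; apply: (pullback_eq h).
    * exact: (f_equal (@proj1_sig _ _) e1).
    * exact: (f_equal (@proj1_sig _ _) e2).
Qed.

Lemma slice_id_terminal (C : Category) (D : C) : IsTerminal (slice_mk (idm D)).
Proof.
move=> X; apply: (@ex_unique _ _ (slice_hom_mk X (slice_mk (idm D)) (comp_idl (projT2 X)))) => //.
move=> y _; apply: slice_hom_eq => /=; rewrite -(comp_idl (proj1_sig y)).
exact/esym/(proj2_sig y).
Qed.

Lemma slice_terminal (C : Category) (D : C) (T : Slice D) : IsTerminal T <-> IsIso (projT2 T).
Proof.
split=> [h|[v [h1 h2]]].
- case: (h (slice_mk (idm D))) => v _; exists (proj1_sig v); split; last exact: (proj2_sig v).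
  have e : v ∘ slice_hom_mk T (slice_mk (idm D)) (comp_idl _) = idm T by apply: terminal_eq.
  exact: (f_equal (@proj1_sig _ _) e).
- move=> X; have hv : projT2 T ∘ (v ∘ projT2 X) = projT2 X by rewrite (comp_pre h2) comp_idl.
  apply: (@ex_unique _ _ (slice_hom_mk X T hv)) => // -[y hy] _; apply: slice_hom_eq => /=.
  by rewrite -hy (comp_pre h1) comp_idl.
Qed.

Lemma slice_product (C : Category) (D : C) (A B P : Slice D) (p1 : Hom P A) (p2 : Hom P B) :
  IsProduct p1 p2 <->
  IsPullback (projT2 A) (projT2 B) (proj1_sig p1) (proj1_sig p2).
Proof.
pose ta (X : Slice D) : Hom X (slice_mk (idm D)) :=
  slice_hom_mk X (slice_mk (idm D)) (comp_idl (projT2 X)).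
have -> : IsPullback (projT2 A) (projT2 B) (proj1_sig p1) (proj1_sig p2) <->
  IsPullback (ta A) (ta B) p1 p2 by rewrite slice_pullback.
split.
- exact/product_terminal_pullback/slice_id_terminal.
- exact/terminal_pullback_product/slice_id_terminal.
Qed.

Lemma slice_functor_lex (C D : Category) (R : Functor C D) (A : C) :
  PreservesFiniteLimits R -> PreservesFiniteLimits (slice_functor R A).
Proof.
move=> h; split=> [T|X Y Z P a b p1 p2].
- by rewrite !slice_terminal; apply: iso_fmap.
- by rewrite !slice_pullback; apply: (pres_pullback h).
Qed.

(** This is the direct image of [F / g^*A -> E / A]: [dir g] of [Y], pulled back along the unit of
    [A]. *)
Lemma slice_couniversal_exists (F E : Topos) (g : GeomMor F E) (A : E) (Y : Slice (inv g A)) :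
  exists (Z : Slice A) (eps : Hom (slice_functor (inv g) A Z) Y), IsCouniversal eps.
Proof.
pose a := inv_dir g.
case: (has_pullbacks (topos_axioms E) (adj_unit a A) (fmap (dir g) (projT2 Y))) => P [p1 [p2 pb]].
have he : projT2 Y ∘ (adj_counit a _ ∘ fmap (inv g) p2) = fmap (inv g) p1.
  rewrite comp_assoc (adj_counit_nat a) -comp_assoc -fmap_comp -(pullback_comm pb).
  by rewrite fmap_comp comp_assoc triangle_l comp_idl.
exists (slice_mk p1), (@slice_hom_mk F (inv g A) (slice_functor (inv g) A (slice_mk p1)) Y _ he).
move=> X y; case: (counit_couniversal a _ _ (proj1_sig y)) => t [ht ut].
have [|w [w1 w2]] := @pullback_ex _ _ _ _ _ _ _ _ _ _ (projT2 X) t pb.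
  apply: (couniversal_eq (counit_couniversal a _)).
  rewrite !fmap_comp comp_assoc triangle_l comp_idl comp_assoc -(adj_counit_nat a) -comp_assoc ht.
  exact/esym/(proj2_sig y).
apply: (@ex_unique _ _ (@slice_hom_mk _ _ X (slice_mk p1) w w1)).
- by apply: slice_hom_eq; rewrite /= -comp_assoc -fmap_comp w2.
- move=> x hx; apply: slice_hom_eq => /=; apply: (pullback_eq pb).
  + rewrite w1; exact/esym/(proj2_sig x).
  + rewrite w2; apply: ut; rewrite fmap_comp comp_assoc.
    exact: (f_equal (@proj1_sig _ _) hx).
Qed.

(** * The fundamental theorem: slices of toposes are toposes *)

(** The object of subsingletons of [X]: those [S] in [Pow X] with
    [S = {x | S = {x}}]. *)
Lemma partial_map_classifier_ex (E : Topos) (X : E) :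
  exists (Xt : E) (e : Hom X Xt), [/\ IsMono e,
    (forall (M Z : E) (m : Hom M Z) (phi : Hom M X), IsMono m ->
      exists chi : Hom Z Xt, forall (T : E) (z : Hom T Z) (x : Hom T X),
        chi ∘ z = e ∘ x <-> exists s, m ∘ s = z /\ phi ∘ s = x) &
    (forall (Z : E) (chi chi' : Hom Z Xt),
      (forall (T : E) (z : Hom T Z) (x : Hom T X), chi ∘ z = e ∘ x <-> chi' ∘ z = e ∘ x) ->
      chi = chi')].
Proof.
case: (singleton_ex X) => sg [msg hsg].
case: (pow_compr (rep_eq (@pfst E (Pow X) X) (sg ∘ psnd))) => th hth.
have {}hth (T : E) (S : Hom T (Pow X)) (x : Hom T X) : mem (th ∘ S) x <-> S = sg ∘ x.
  by rewrite hth fst_pair -comp_assoc snd_pair.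
case: (equalizer_ex th (idm _)) => Xt [i [mi _ hi]].
have [|e he] := proj1 (hi _ sg).
  apply: pow_ext => T x y; rewrite comp_idl -comp_assoc hth hsg.
  by split=> [/msg|->].
have hie : th ∘ i = i by rewrite -[RHS]comp_idl; apply/hi; exists (idm _); rewrite comp_idr.
have key (T : E) (z : Hom T Xt) (x : Hom T X) : mem (i ∘ z) x <-> z = e ∘ x.
  rewrite -{1}hie -comp_assoc hth -he -comp_assoc; split=> [/mi //|-> //].
exists Xt, e; split.
- by move=> W u v huv; apply: msg; rewrite -he -!comp_assoc huv.
- move=> M Z m phi mm.
  have mp : IsMono ⟨m, phi⟩ by move=> W u v; rewrite !pair_comp => /pair_inj [/mm].
  (* [S z] is the set of values of the partial map [phi] at [z]; it has at most one element because
     [m] is monic. *)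
  case: (pow_compr (rep_mono mp)) => S hS.
  have {}hS (T : E) (z : Hom T Z) (x : Hom T X) :
    mem (S ∘ z) x <-> exists s, m ∘ s = z /\ phi ∘ s = x.
    rewrite hS; split=> -[s]; first by rewrite pair_comp => /pair_inj; exists s.
    by move=> [<- <-]; exists s; rewrite pair_comp.
  have hS2 (T : E) (z : Hom T Z) (x : Hom T X) : S ∘ z = sg ∘ x <-> mem (S ∘ z) x.
    split=> [->|]; first exact/hsg.
    move=> /hS [s [hs1 hs2]]; apply: pow_ext => T' r y.
    rewrite -!comp_assoc hsg hS; split.
    + move=> [s' [h1 h2]]; rewrite -h2 -hs2 -comp_assoc; congr (_ ∘ _).
      by apply: mm; rewrite h1 comp_assoc hs1.
    + by move=> <-; exists (s ∘ r); rewrite !comp_assoc hs1 hs2.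
  have [|chi hchi] := proj1 (hi _ S).
    apply: pow_ext => T z x; rewrite comp_idl -comp_assoc hth; exact: hS2.
  by exists chi => T z x; rewrite -key comp_assoc hchi hS.
- move=> Z chi chi' h; apply: mi; apply: pow_ext => T z x.
  by rewrite -!comp_assoc !key.
Qed.

Lemma classifier_intro (C : Category) (T Omega : C) (t : Hom T Omega) :
  IsTerminal T ->
  (forall (A X : C) (m : Hom A X), IsMono m ->
    exists ! chi : Hom X Omega, forall (Y : C) (x : Hom Y X),
      (exists b, chi ∘ x = t ∘ b) <-> exists s, m ∘ s = x) ->
  IsSubobjectClassifier t.
Proof.
move=> hT h; split=> // A X m hm; case: (h A X m hm) => chi [hc uc].
have [b hb] : exists b, chi ∘ m = t ∘ b by apply/hc; exists (idm A); rewrite comp_idr.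
exists chi; split.
- exists b; apply: pullback_intro => // [Y x y e|Y u v e _]; last exact: hm.
  case: (proj1 (hc _ x)); first by exists y.
  by move=> s hs; exists s; split=> //; apply: terminal_eq.
- move=> chi' [b' pb]; apply: uc => Y x; split.
  + by move=> [y /(pullback_ex pb) [s [hs _]]]; exists s.
  + by move=> [s <-]; exists (b' ∘ s); rewrite !comp_assoc (pullback_comm pb).
Qed.

Lemma slice_mono (C : Category) (D : C) (X Y : Slice D) (m : Hom X Y) :
  IsMono m <-> IsMono (proj1_sig m).
Proof.
split=> h W u v e.
- have hu : projT2 X ∘ u = projT2 (slice_mk (projT2 X ∘ u)) by [].
  have hv : projT2 X ∘ v = projT2 (slice_mk (projT2 X ∘ u)).
    by rewrite /= -(proj2_sig m) -!comp_assoc e.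
  have h' := h _ (slice_hom_mk (slice_mk _) X hu) (slice_hom_mk (slice_mk _) X hv).
  by apply: (f_equal (@proj1_sig _ _) (h' _)); apply: slice_hom_eq.
- by apply: slice_hom_eq; apply: h; apply: (f_equal (@proj1_sig _ _) e).
Qed.

(** Subobjects of an object over [D] are subobjects of its total object, so the constant family
    [D × Om E] classifies them. *)
Lemma slice_classifier (E : Topos) (D : E) :
  exists (T Omega : Slice D) (t : Hom T Omega), IsSubobjectClassifier t.
Proof.
pose O : Slice D := slice_mk (@pfst E D (Om E)).
have ht : projT2 O ∘ ⟨idm D, truth D⟩ = projT2 (slice_mk (idm D)) by rewrite fst_pair.
exists (slice_mk (idm D)), O, (slice_hom_mk (slice_mk (idm D)) O ht); apply: classifier_intro.
  exact: slice_id_terminal.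
move=> A X m /slice_mono mm.
have eqv (chi : Hom X O) (Y : Slice D) (x : Hom Y X) :
  (exists b, chi ∘ x = slice_hom_mk (slice_mk (idm D)) O ht ∘ b) <->
  holds ((psnd ∘ proj1_sig chi) ∘ proj1_sig x).
  split.
  - move=> [b /(f_equal (@proj1_sig _ _)) /= e]; rewrite /holds -comp_assoc e comp_assoc snd_pair.
    exact: tt_comp.
  - move=> e; exists (slice_hom_mk Y (slice_mk (idm D)) (comp_idl (projT2 Y))).
    apply: slice_hom_eq => /=; apply: prd_eq; rewrite !comp_assoc ?fst_pair ?snd_pair ?comp_idl.
    + rewrite (proj2_sig chi : pfst ∘ proj1_sig chi = _); exact: (proj2_sig x).
    + by rewrite tt_comp.
have sub (Y : Slice D) (x : Hom Y X) :
  (exists s, m ∘ s = x) <-> (exists s, proj1_sig m ∘ s = proj1_sig x).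
  split=> [[s <-]|[s hs]]; first by exists (proj1_sig s).
  have h : projT2 A ∘ s = projT2 Y by rewrite -(proj2_sig m) -comp_assoc hs (proj2_sig x).
  by exists (slice_hom_mk Y A h); apply: slice_hom_eq.
case: (chi_ex mm) => chi hchi.
have hc : projT2 O ∘ ⟨projT2 X, chi⟩ = projT2 X by rewrite fst_pair.
exists (slice_hom_mk X O hc); split.
- by move=> Y x; rewrite eqv sub -hchi /= snd_pair.
- move=> chi' h'; apply: slice_hom_eq => /=; apply: prd_eq; rewrite ?fst_pair ?snd_pair.
    exact/esym/(proj2_sig chi').
  apply: omega_ext => T t; rewrite hchi.
  have hx : projT2 X ∘ t = projT2 (slice_mk (projT2 X ∘ t)) by [].
  by rewrite -(sub _ (slice_hom_mk (slice_mk _) X hx)) -h' eqv.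
Qed.

(** The fibre over [d] consists of the partial maps from [Y] to [X] whose domain is the fibre of [Y]
    over [d] and whose values lie over [d]. With partial map classifiers this becomes a single
    equation. *)
Lemma slice_exponential (E : Topos) (D : E) (A B : Slice D) :
  exists (X P : Slice D) (p1 : Hom P X) (p2 : Hom P A) (ev : Hom P B), IsExponential p1 p2 ev.
Proof.
case: A B => Y y [X x].
case: (partial_map_classifier_ex D) => Dt [ed [med pmd extd]].
case: (partial_map_classifier_ex X) => Xt [e [me pm ext]].
(* [xt] applies [x] to a partial element of [X], and [de (d, b)] below is the partial element [d] of
   [D], defined when [b] lies over [d]. The pullback [E0] makes them agree for every [b], which
   fixes the domain and the fibre at once. *)
case: (pmd _ _ e x me) => xt hxt.
have my : IsMono ⟨y, idm Y⟩ by move=> W u v; rewrite !pair_comp !comp_idl => /pair_inj [_].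
case: (pmd _ _ ⟨y, idm Y⟩ y my) => de hde.
have {}hde (T : E) (d d' : Hom T D) (b : Hom T Y) :
  de ∘ ⟨d, b⟩ = ed ∘ d' <-> y ∘ b = d /\ d = d'.
  rewrite hde; split.
  - by move=> [s [hs <-]]; move: hs; rewrite pair_comp comp_idl => /pair_inj [<- <-].
  - by move=> [<- <-]; exists b; rewrite pair_comp comp_idl.
case: (has_pullbacks (topos_axioms E) (curry de) (curry (xt ∘ @ev E Y Xt))) => E0 [pi [rho pb]].
have hE0 (T : E) (a : Hom T E0) (b : Hom T Y) :
  de ∘ ⟨pi ∘ a, b⟩ = xt ∘ (ev ∘ ⟨rho ∘ a, b⟩).
  rewrite -ev_curry comp_assoc (pullback_comm pb) -comp_assoc ev_curry -comp_assoc //.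
case: (has_pullbacks (topos_axioms E) pi y) => P0 [u1 [u2 pbP]].
have [s [hs1 hs2]] : exists s, e ∘ s = ev ∘ ⟨rho ∘ u1, u2⟩ /\ x ∘ s = pi ∘ u1.
  by apply/hxt; rewrite -hE0; apply/hde; rewrite (pullback_comm pbP).
have hu2 : projT2 (slice_mk y) ∘ u2 = projT2 (slice_mk (pi ∘ u1)) by rewrite /= (pullback_comm pbP).
have hs : projT2 (slice_mk x) ∘ s = projT2 (slice_mk (pi ∘ u1)) by [].
exists (slice_mk pi), (slice_mk (pi ∘ u1)).
exists (@slice_hom_mk _ _ (slice_mk (pi ∘ u1)) (slice_mk pi) u1 erefl).
exists (slice_hom_mk (slice_mk (pi ∘ u1)) (slice_mk y) hu2).
exists (slice_hom_mk (slice_mk (pi ∘ u1)) (slice_mk x) hs); split; first exact/slice_product.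
move=> [T t] [Q q] [q1 hq1] [q2 hq2] /slice_product /= pbQ [g hg].
simpl in q1, hq1, q2, hq2, pbQ, g, hg.
have mq : IsMono ⟨q1, q2⟩.
  by move=> W u v; rewrite !pair_comp => /pair_inj [e1 e2]; apply: (pullback_eq pbQ).
(* A map [g] on the fibre product is a partial map from [T × Y] to [X]; [chi] is its total
   extension, and [curry chi] gives the transpose. *)
case: (pm _ _ ⟨q1, q2⟩ g mq) => chi hchi.
have {}hchi (T' : E) (z : Hom T' T) (b : Hom T' Y) (x' : Hom T' X) :
  chi ∘ ⟨z, b⟩ = e ∘ x' <-> exists w, [/\ q1 ∘ w = z, q2 ∘ w = b & g ∘ w = x'].
  rewrite hchi; split=> -[w].
  - by rewrite pair_comp => -[/pair_inj [<- <-] <-]; exists w.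
  - by move=> [<- <- <-]; exists w; rewrite pair_comp.
have chig : chi ∘ ⟨q1, q2⟩ = e ∘ g by apply/hchi; exists (idm _); rewrite !comp_idr.
have [|h [h1 h2]] := @pullback_ex _ _ _ _ _ _ _ _ _ _ t (curry chi) pb.
  apply: curry_eq => T' z b; rewrite -!comp_assoc !ev_curry -comp_assoc ev_curry.
  apply: extd => T'' r d; rewrite -!comp_assoc !pair_comp -comp_assoc hde hxt; split.
  - move=> [e1 e2]; have [|w [w1 w2]] := @pullback_ex _ _ _ _ _ _ _ _ _ _ (z ∘ r) (b ∘ r) pbQ.
      by rewrite e1.
    exists (g ∘ w); split; last by rewrite comp_assoc hg -hq1 -comp_assoc w1.
    by apply/esym/hchi; exists w.
  - move=> [x' [/esym /hchi [w [w1 w2 w3]] hx']].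
    have e1 : t ∘ (z ∘ r) = q ∘ w by rewrite -w1 comp_assoc hq1.
    split; first by rewrite -w2 comp_assoc hq2.
    by rewrite e1 -hx' -w3 comp_assoc hg.
apply: (@ex_unique _ _ (@slice_hom_mk _ _ (slice_mk t) (slice_mk pi) h h1)).
- have [|k [k1 k2]] := @pullback_ex _ _ _ _ _ _ _ _ _ _ (h ∘ q1) q2 pbP.
    by rewrite comp_assoc h1 (pullback_comm pbQ).
  have hk : projT2 (slice_mk (pi ∘ u1)) ∘ k = projT2 (slice_mk q).
    by rewrite /= -comp_assoc k1 comp_assoc h1.
  exists (slice_hom_mk (slice_mk q) (slice_mk (pi ∘ u1)) hk); split; first exact: slice_hom_eq.
  split; first exact: slice_hom_eq.
  apply: slice_hom_eq => /=; apply: me.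
  by rewrite comp_assoc hs1 -comp_assoc pair_comp -comp_assoc k1 k2 comp_assoc h2 ev_curry.
- move=> [h' hh'] [[k hk] [k1 [k2 k3]]]; apply: slice_hom_eq => /=.
  move: k1 k2 k3 => /(f_equal (@proj1_sig _ _)) /= k1 /(f_equal (@proj1_sig _ _)) /= k2.
  move=> /(f_equal (@proj1_sig _ _)) /= k3; simpl in h', hh', k, hk, k1, k2, k3.
  have key (T' : E) (w : Hom T' Q) : ev ∘ ⟨rho ∘ (h' ∘ (q1 ∘ w)), q2 ∘ w⟩ = e ∘ (g ∘ w).
    rewrite -k3 -comp_assoc (comp_assoc e) hs1 -comp_assoc pair_comp -!comp_assoc.
    by rewrite (comp_pre k2) (comp_pre k1) -!comp_assoc.
  apply: (pullback_eq pb); first by rewrite h1.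
  rewrite h2; apply: curry_eq => T' z b; rewrite ev_curry; apply: ext => T'' r x'.
  rewrite -!comp_assoc !pair_comp -!comp_assoc hchi; split.
  - by move=> [w [<- <- <-]]; rewrite key.
  - move=> e1; have : de ∘ ⟨pi ∘ (h' ∘ (z ∘ r)), b ∘ r⟩ = ed ∘ (x ∘ x').
      by rewrite hE0 e1; apply/hxt; exists x'.
    move=> /hde [e2 _]; have [|w [w1 w2]] := @pullback_ex _ _ _ _ _ _ _ _ _ _ (z ∘ r) (b ∘ r) pbQ.
      by rewrite e2 (comp_assoc pi) hh'.
    exists w; split=> //; apply: me; rewrite -key w1 w2 //.
Qed.

Lemma slice_topos (E : Topos) (D : E) : IsElementaryTopos (Slice D).
Proof.
split.
- by exists (slice_mk (idm D)); apply: slice_id_terminal.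
- move=> A B X a b.
  case: (has_pullbacks (topos_axioms E) (proj1_sig a) (proj1_sig b)) => P [p1 [p2 pb]].
  have h2 : projT2 B ∘ p2 = projT2 A ∘ p1.
    by rewrite -(proj2_sig b) -(proj2_sig a) -!comp_assoc (pullback_comm pb).
  exists (slice_mk (projT2 A ∘ p1)).
  exists (@slice_hom_mk _ _ (slice_mk (projT2 A ∘ p1)) A p1 erefl).
  by exists (@slice_hom_mk _ _ (slice_mk (projT2 A ∘ p1)) B p2 h2); apply/slice_pullback.
- exact: slice_exponential.
- exact: slice_classifier.
Qed.

(** * Closed subtoposes *)

(** For subterminal [V] this is [InClosedSubtopos] (see [closedob_iff]) freed of products, a form
    that passes directly to limits, exponentials and right adjoints. *)
Definition ClosedOb (C : Category) (V Y : C) : Prop :=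
  forall (T : C) (v : Hom T V), inhabited (Hom T Y) /\ forall y y' : Hom T Y, y = y'.

Lemma closed_subtopos_closedob (C : Category) (V Y P : C) (p1 : Hom P Y) (p2 : Hom P V) :
  IsProduct p1 p2 -> InClosedSubtopos V Y -> ClosedOb V Y.
Proof.
move=> hP /(_ _ _ _ hP) hi; case: (hi) => w _ T v; split.
  exact: (inhabits (p1 ∘ w ∘ v)).
move=> y y'; case: (product_ex y v hP) => u [<- hu]; case: (product_ex y' v hP) => u' [<- hu'].
by congr (_ ∘ _); apply: (iso_mono hi); rewrite hu hu'.
Qed.

Lemma closedob_closed_subtopos (C : Category) (V Y : C) :
  IsSubterminal V -> ClosedOb V Y -> InClosedSubtopos V Y.
Proof.
move=> sV h P p1 p2 hP; case: (h V (idm V)) => -[y] _.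
case: (product_ex y (idm V) hP) => u [hu1 hu2]; exists u; split=> //.
apply: (product_eq hP); last exact: sV.
exact: (proj2 (h P p2)).
Qed.

Lemma closedob_iff (E : Topos) (V Y : E) : IsSubterminal V ->
  InClosedSubtopos V Y <-> ClosedOb V Y.
Proof.
move=> sV; split; last exact: closedob_closed_subtopos.
exact: closed_subtopos_closedob (@prd_product E Y V).
Qed.

Lemma closedob_pullback (C : Category) (V A B D P : C) (a : Hom A D) (b : Hom B D)
  (p1 : Hom P A) (p2 : Hom P B) :
  ClosedOb V A -> ClosedOb V B -> ClosedOb V D -> IsPullback a b p1 p2 -> ClosedOb V P.
Proof.
move=> hA hB hD pb T v; split.
- case: (hA T v) => -[x] _; case: (hB T v) => -[y] _.
  by case: (pullback_ex (x := x) (y := y) pb); first exact: (proj2 (hD T v)).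
- by move=> y y'; apply: (pullback_eq pb); [apply: (proj2 (hA T v))|apply: (proj2 (hB T v))].
Qed.

Lemma closedob_terminal (C : Category) (V T : C) : IsTerminal T -> ClosedOb V T.
Proof.
move=> hT X v; split; first by case: (hT X).
by move=> y y'; apply: terminal_eq.
Qed.

Lemma closedob_exponential (E : Topos) (V A B : E) :
  ClosedOb V B -> ClosedOb V (exponential A B).
Proof.
move=> hB T v; split.
- case: (hB (T × A) (v ∘ pfst)) => -[g] _; exact: (inhabits (curry g)).
- by move=> y y'; apply: curry_eq => T' r a; apply: (proj2 (hB T' (v ∘ r))).
Qed.

Lemma closedob_map (C : Category) (V V' Y : C) (u : Hom V V') : ClosedOb V' Y -> ClosedOb V Y.
Proof. by move=> h T v; apply: (h T (u ∘ v)). Qed.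

Lemma closedob_iso (C : Category) (V Y Y' : C) (u : Hom Y Y') :
  IsIso u -> ClosedOb V Y -> ClosedOb V Y'.
Proof.
move=> [w [h1 h2]] h T v; case: (h T v) => -[y] uy; split; first exact: (inhabits (u ∘ y)).
by move=> a b; rewrite -(comp_idl a) -(comp_idl b) -h2 -!comp_assoc (uy (w ∘ a) (w ∘ b)).
Qed.

Lemma closedob_right_adjoint (C D : Category) (L : Functor C D) (R : Functor D C)
  (a : Adjunction L R) (V Y : D) : ClosedOb V Y -> ClosedOb (R V) (R Y).
Proof.
move=> h T v; case: (h (L T) (transpose a v)) => -[y] uy; split.
  exact: (inhabits (fmap R y ∘ adj_unit a T)).
by move=> x x'; rewrite -(transpose_unit a x) (uy (transpose a x) (transpose a x')) transpose_unit.
Qed.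

(** A stage over [R V] need not come from [E], so the argument returns to the invertible projection
    onto [V], which [R] preserves. *)
Lemma closedob_lex (E : Topos) (D : Category) (R : Functor E D) (V Y : E) :
  PreservesFiniteLimits R -> IsSubterminal V -> ClosedOb V Y -> ClosedOb (R V) (R Y).
Proof.
move=> lex sV hY T v.
have hi := closedob_closed_subtopos sV hY (@prd_product E Y V).
case: (hi) => w _; split; first exact: (inhabits (fmap R (pfst ∘ w) ∘ v)).
move=> y y'; case: (product_ex y v (@lex_prd _ _ _ lex Y V)) => u [<- e2].
case: (product_ex y' v (@lex_prd _ _ _ lex Y V)) => u' [<- e4].
by congr (_ ∘ _); apply: (iso_mono (iso_fmap R hi)); rewrite e2 e4.
Qed.

Lemma subterminal_lex (E : Topos) (D : Category) (R : Functor E D) (V : E) :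
  PreservesFiniteLimits R -> IsSubterminal V -> IsSubterminal (R V).
Proof.
move=> lex sV T u v; case: (product_ex u v (@lex_prd _ _ _ lex V V)) => w [<- <-].
by rewrite (sV _ (@pfst E V V) psnd).
Qed.

(** * Closed truth values, and maps orthogonal to the closed objects *)

Lemma rep_stable (E : Topos) (Z : E) (phi : forall T : E, Hom T Z -> Prop)
  (T T' : E) (t : Hom T Z) (r : Hom T' T) : Rep phi -> phi T t -> phi T' (t ∘ r).
Proof. by move=> [chi h] /h ht; apply/h; rewrite comp_assoc; apply: holds_comp. Qed.

(** [J] consists of the truth values implied by [V], which are those of the closed subtopos. *)
Lemma closed_truth_ex (E : Topos) (V : E) :
  exists (J : E) (j : Hom J (Om E)), [/\ IsMono j, ClosedOb V J,
    (forall (T : E) (q : Hom T J), Hom T V -> holds (j ∘ q)) &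
    forall (T : E) (p : Hom T (Om E)),
      (forall (T' : E) (r : Hom T' T), Hom T' V -> holds (p ∘ r)) -> exists q, j ∘ q = p].
Proof.
case: (rep_sub (rep_all (rep_holds (@pfst E (Om E) V)))) => J [j [mj hj]].
have {}hj (T : E) (p : Hom T (Om E)) :
  (forall (T' : E) (r : Hom T' T), Hom T' V -> holds (p ∘ r)) <-> exists q, j ∘ q = p.
  rewrite -hj; split=> h T' r v; first by rewrite fst_pair; apply: h.
  by move: (h T' r v); rewrite fst_pair.
have jV (T : E) (q : Hom T J) : Hom T V -> holds (j ∘ q).
  by move=> v; rewrite -(comp_idr q) comp_assoc; apply: (proj2 (hj T (j ∘ q))) => //; exists q.
exists J, j; split=> //; last by move=> T p /hj.
move=> T v; split.
- by case: (proj1 (hj T (truth T))) => [T' r _|q _]; [apply: tt_comp|exact: (inhabits q)].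
- by move=> y y'; apply: mj; rewrite (jV _ y v) (jV _ y' v).
Qed.

(** [exponential X J] is the object of those subobjects of [X] that contain everything lying over
    [V]. *)
Lemma closed_pow_compr (E : Topos) (V J X Z : E) (j : Hom J (Om E))
  (phi : forall T : E, Hom T (Z × X) -> Prop) :
  (forall (T : E) (p : Hom T (Om E)),
     (forall (T' : E) (r : Hom T' T), Hom T' V -> holds (p ∘ r)) -> exists q, j ∘ q = p) ->
  Rep phi -> (forall (T : E) (t : Hom T (Z × X)), Hom T V -> phi T t) ->
  exists S : Hom Z (exponential X J), forall (T : E) (z : Hom T Z) (x : Hom T X),
    holds (j ∘ (ev ∘ ⟨S ∘ z, x⟩)) <-> phi T ⟨z, x⟩.
Proof.
move=> hJ [chi hc] hV; case: (hJ _ chi) => [T r v|q hq]; first by apply/hc/hV.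
by exists (curry q) => T z x; rewrite ev_curry comp_assoc hq hc.
Qed.

Lemma closed_pow_ext (E : Topos) (J X Z : E) (j : Hom J (Om E))
  (S S' : Hom Z (exponential X J)) : IsMono j ->
  (forall (T : E) (z : Hom T Z) (x : Hom T X),
    holds (j ∘ (ev ∘ ⟨S ∘ z, x⟩)) <-> holds (j ∘ (ev ∘ ⟨S' ∘ z, x⟩))) -> S = S'.
Proof.
move=> mj h; apply: curry_eq => T z x; apply: mj; apply: omega_ext => T' r.
by rewrite -!comp_assoc !pair_comp -!comp_assoc; apply: h.
Qed.

(** The maps inverted by the reflection onto the closed objects, described without that
    reflection. *)
Definition IsOrthogonal (C : Category) (V Z Z' : C) (k : Hom Z Z') : Prop :=
  forall Y : C, ClosedOb V Y -> forall y : Hom Z Y, exists ! y' : Hom Z' Y, y' ∘ k = y.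

Lemma orthogonal_eq (C : Category) (V Z Z' : C) (k : Hom Z Z') (Y : C) (y y' : Hom Z' Y) :
  IsOrthogonal V k -> ClosedOb V Y -> y ∘ k = y' ∘ k -> y = y'.
Proof. by move=> h hY e; apply: (unique_eq (h _ hY (y' ∘ k))). Qed.

Lemma orthogonal_id (C : Category) (V Z : C) : IsOrthogonal V (idm Z).
Proof.
by move=> Y _ y; apply: (@ex_unique _ _ y) => [|y' <-]; rewrite comp_idr.
Qed.

Lemma orthogonal_comp (C : Category) (V X Y Z : C) (l : Hom Y Z) (k : Hom X Y) :
  IsOrthogonal V l -> IsOrthogonal V k -> IsOrthogonal V (l ∘ k).
Proof.
move=> hl hk W hW w; case: (hk _ hW w) => w' [e' _]; case: (hl _ hW w') => w'' [e'' _].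
apply: (@ex_unique _ _ w'') => [|y e]; first by rewrite comp_assoc e''.
apply: (orthogonal_eq hl hW); apply: (orthogonal_eq hk hW).
by rewrite e'' e' -comp_assoc e.
Qed.

Lemma orthogonal_cancel (C : Category) (V X Y Z : C) (l : Hom Y Z) (k : Hom X Y) :
  IsOrthogonal V l -> IsOrthogonal V (l ∘ k) -> IsOrthogonal V k.
Proof.
move=> hl hlk W hW w; case: (hlk _ hW w) => z [e _].
apply: (@ex_unique _ _ (z ∘ l)) => [|y ey]; first by rewrite -comp_assoc.
case: (hl _ hW y) => z' [e' _]; rewrite -e'; congr (_ ∘ _).
by apply: (orthogonal_eq hlk hW); rewrite e comp_assoc e'.
Qed.

(** Universal quantification along [t] turns [phi] into a closed subobject of
    [Z'] containing the image of [k]; maps from [Z'] to the closed truth values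
    are determined by their restriction along [k]. *)
Lemma orthogonal_cover (E : Topos) (V Z Z' T P : E) (k : Hom Z Z') (t : Hom T Z')
  (pT : Hom P T) (pZ : Hom P Z) (phi : forall X : E, Hom X T -> Prop) :
  IsOrthogonal V k -> IsPullback t k pT pZ -> Rep phi ->
  (forall (X : E) (x : Hom X T), Hom X V -> phi X x) -> phi P pT ->
  forall (X : E) (x : Hom X T), phi X x.
Proof.
move=> hk pb rphi hV hP.
case: (closed_truth_ex V) => J [j [mj cJ jV hJ]].
case: (rep_all_imp (rep_eq (t ∘ psnd) (@pfst E Z' T)) (rep_pull psnd rphi)) => chi hchi.
have {}hchi (X : E) (z : Hom X Z') : holds (chi ∘ z) <->
  forall (X' : E) (r : Hom X' X) (x : Hom X' T), t ∘ x = z ∘ r -> phi X' x.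
  rewrite hchi; split=> h X' r x.
  - by move: (h X' r x); rewrite -comp_assoc fst_pair snd_pair.
  - by rewrite -comp_assoc fst_pair snd_pair; apply: h.
case: (hJ _ chi) => [X z v|q hq].
  by apply/hchi => X' r x _; apply: hV; apply: (v ∘ r).
case: (hJ _ (truth Z')) => [X z v|q0 hq0]; first exact: tt_comp.
have e : q = q0.
  apply: (orthogonal_eq hk cJ); apply: mj; rewrite !comp_assoc hq hq0 tt_comp.
  apply/hchi => X' r x /(pullback_ex pb) [w [<- _]].
  exact: rep_stable.
move=> X x; have /hchi h : holds (chi ∘ (t ∘ x)).
  by rewrite -hq e hq0; apply: tt_comp.
by apply: (h X (idm X)); rewrite comp_idr.
Qed.

(** This carries the exactness of the reflection. To extend [s] along [pT], its graph is written as
    a family of closed subobjects indexed by [Z], the family is extended along [k], and its values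
    turn out to be singletons. *)
Lemma orthogonal_pullback (E : Topos) (V Z Z' T P : E) (k : Hom Z Z') (t : Hom T Z')
  (pT : Hom P T) (pZ : Hom P Z) :
  IsOrthogonal V k -> IsPullback t k pT pZ -> IsOrthogonal V pT.
Proof.
move=> hk pb Y hY s; have cover := orthogonal_cover hk pb.
(* Equality of maps to a closed object is automatic over [V], so it spreads from [P] to [T]. *)
have uniq (y y' : Hom T Y) : y ∘ pT = y' ∘ pT -> y = y'.
  move=> e; rewrite -(comp_idr y) -(comp_idr y').
  apply: (cover _ (rep_eq y y')) => // X x v; exact: (proj2 (hY _ v)).
suff [y hy] : exists y, y ∘ pT = s.
  by apply: (@ex_unique _ _ y) => // y' e; apply: uniq; rewrite hy.
case: (closed_truth_ex V) => J [j [mj cJ jV hJ]].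
(* [S z] will be the set of pairs [(x, y)] such that [y] is the value of [s] at the point of [P]
   over [x] and [z], if there is one. The conclusion is an equation in [Y], hence automatic over
   [V]. *)
have rS := rep_all_imp
  (rep_and (rep_eq (pT ∘ psnd) (pfst ∘ (psnd ∘ @pfst E (Z × (T × Y)) P)))
           (rep_eq (pZ ∘ psnd) (pfst ∘ @pfst E (Z × (T × Y)) P)))
  (rep_eq (psnd ∘ (psnd ∘ @pfst E (Z × (T × Y)) P)) (s ∘ psnd)).
case: (closed_pow_compr hJ rS).
  move=> X x v X' r w _; exact: (proj2 (hY _ (v ∘ r))).
move=> S hS.
have {rS}hS (X : E) (z : Hom X Z) (x : Hom X T) (y : Hom X Y) :
  holds (j ∘ (ev ∘ ⟨S ∘ z, ⟨x, y⟩⟩)) <->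
  forall (X' : E) (r : Hom X' X) (w : Hom X' P), pT ∘ w = x ∘ r -> pZ ∘ w = z ∘ r ->
    y ∘ r = s ∘ w.
  rewrite hS; split=> h X' r w.
  - move=> h1 h2; move: (h X' r w); rewrite -!comp_assoc !fst_pair !snd_pair !pair_comp.
    by rewrite !snd_pair !fst_pair; apply.
  - move: (h X' r w); rewrite -!comp_assoc !fst_pair !snd_pair !pair_comp.
    by rewrite !snd_pair !fst_pair => h' [h1 h2]; apply: h'.
case: (hk _ (closedob_exponential (T × Y) cJ) S) => S' [hS' _].
(* [R x] will be the set of the [y] with [(x, y)] in the extended family at [t x]; along [pT] it is
   the singleton of the value of [s]. *)
have rR : Rep (fun (X : E) (u : Hom X (T × Y)) =>
  holds (j ∘ (ev ∘ ⟨S' ∘ (t ∘ (pfst ∘ u)), u⟩))).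
  apply: rep_ext (rep_holds (j ∘ (ev ∘ ⟨S' ∘ (t ∘ pfst), idm _⟩))) => X u.
  by rewrite -!comp_assoc pair_comp comp_idl -!comp_assoc.
case: (closed_pow_compr hJ rR) => [X u v|R hR]; first exact: jV.
case: (closed_pow_compr hJ (rep_eq (@pfst E Y Y) psnd)) => [X u v|sg hsg].
  exact: (proj2 (hY _ v)).
have {}hsg (X : E) (y y' : Hom X Y) : holds (j ∘ (ev ∘ ⟨sg ∘ y, y'⟩)) <-> y = y'.
  by rewrite hsg fst_pair snd_pair.
have msg : IsMono sg by move=> X u v e; apply/hsg; rewrite e; apply/hsg.
have cov : sg ∘ s = R ∘ pT.
  apply: (closed_pow_ext mj) => X w y; rewrite -!comp_assoc hsg hR fst_pair.
  rewrite (comp_assoc t) (pullback_comm pb) -comp_assoc (comp_assoc S') hS' hS; split.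
  - move=> <- X' r w' h1 h2; rewrite -comp_assoc; congr (_ ∘ _).
    by apply: (pullback_eq pb); rewrite ?h1 ?h2 comp_assoc.
  - by move=> h; move: (h X (idm X) w); rewrite !comp_idr => ->.
(* [N] is the part of [T] where [R] is a singleton. It contains the image of [pT] and all that lies
   over [V], hence is all of [T]. *)
case: (has_pullbacks (topos_axioms E) R sg) => N [n [n' pbN]].
have mn : IsMono n.
  move=> X u v e; apply: (pullback_eq pbN) => //; apply: msg.
  by rewrite !comp_assoc -(pullback_comm pbN) -!comp_assoc e.
have [n0 hn0] : exists n0, n ∘ n0 = idm T; first apply: (cover _ (rep_mono mn)).
- move=> X x v; case: (hY X v) => -[y] _.
  have [|u [hu _]] := @pullback_ex _ _ _ _ _ _ _ _ _ _ x y pbN; last by exists u.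
  exact: (proj2 (closedob_exponential Y cJ v)).
- by case: (pullback_ex pbN (esym cov)) => u [hu _]; exists u.
- exists (n' ∘ n0); apply: msg; rewrite cov comp_assoc (comp_assoc sg) -(pullback_comm pbN).
  by rewrite -(comp_assoc R) hn0 comp_idr.
Qed.

(** The map [n] is a composite that replaces [D], [B] and [A] one at a time. Replacing [B] or [A] is
    a pullback of [kb] or [ka]. Replacing [D] is a pullback of the diagonal of [kd], which is
    orthogonal because it is a section of a projection of the kernel pair, itself a pullback of
    [kd]. *)
Lemma orthogonal_cube (E : Topos) (V : E)
  (A B D P : E) (a : Hom A D) (b : Hom B D) (p1 : Hom P A) (p2 : Hom P B)
  (A' B' D' P' : E) (a' : Hom A' D') (b' : Hom B' D') (p1' : Hom P' A') (p2' : Hom P' B')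
  (ka : Hom A A') (kb : Hom B B') (kd : Hom D D') (n : Hom P P') :
  IsPullback a b p1 p2 -> IsPullback a' b' p1' p2' ->
  IsOrthogonal V ka -> IsOrthogonal V kb -> IsOrthogonal V kd ->
  kd ∘ a = a' ∘ ka -> kd ∘ b = b' ∘ kb -> p1' ∘ n = ka ∘ p1 -> p2' ∘ n = kb ∘ p2 ->
  IsOrthogonal V n.
Proof.
move=> pb pb' hka hkb hkd ea eb n1 n2.
have pbs := has_pullbacks (topos_axioms E).
case: (pbs _ _ _ (kd ∘ a) (kd ∘ b)) => P1 [q1 [q2 pb1]].
case: (pbs _ _ _ (kd ∘ a) b') => P2 [r1 [r2 pb2]].
case: (pbs _ _ _ kd kd) => K [k1 [k2 pbK]].
have [|d [d1 d2]] := @pullback_ex _ _ _ _ _ _ _ _ _ _ (idm D) (idm D) pbK; first by [].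
have hd : IsOrthogonal V d.
  apply: (orthogonal_cancel (l := k1)); first exact: (orthogonal_pullback hkd pbK).
  by rewrite d1; apply: orthogonal_id.
have [|m1 [m11 m12]] := @pullback_ex _ _ _ _ _ _ _ _ _ _ p1 p2 pb1.
  by rewrite -!comp_assoc (pullback_comm pb).
have [|c [c1 c2]] := @pullback_ex _ _ _ _ _ _ _ _ _ _ (a ∘ q1) (b ∘ q2) pbK.
  by rewrite !comp_assoc (pullback_comm pb1).
have h1 : IsOrthogonal V m1.
  apply: (orthogonal_pullback hd (t := c) (pZ := a ∘ p1)).
  apply: pullback_intro.
  - apply: (pullback_eq pbK); rewrite !comp_assoc.
    + by rewrite c1 d1 comp_idl -comp_assoc m11.
    + by rewrite c2 d2 comp_idl -comp_assoc m12 (pullback_comm pb).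
  - move=> X x y e; have [|u [u1 u2]] := @pullback_ex _ _ _ _ _ _ _ _ _ _ (q1 ∘ x) (q2 ∘ x) pb.
      by rewrite !comp_assoc -c1 -c2 -!comp_assoc e !comp_assoc d1 d2.
    exists u; split.
    + by apply: (pullback_eq pb1); rewrite comp_assoc ?m11 ?m12 ?u1 ?u2.
    + by rewrite -comp_assoc u1 comp_assoc -c1 -comp_assoc e comp_assoc d1 comp_idl.
  - move=> X u v e _; apply: (pullback_eq pb).
    + by rewrite -m11 -!comp_assoc e.
    + by rewrite -m12 -!comp_assoc e.
have [|m2 [m21 m22]] := @pullback_ex _ _ _ _ _ _ _ _ _ _ q1 (kb ∘ q2) pb2.
  by rewrite (pullback_comm pb1) eb -comp_assoc.
have h2 : IsOrthogonal V m2.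
  apply: (orthogonal_pullback hkb (t := r2) (pZ := q2)); apply: pullback_intro => //.
  - move=> X x y e; have [|u [u1 u2]] := @pullback_ex _ _ _ _ _ _ _ _ _ _ (r1 ∘ x) y pb1.
      by rewrite comp_assoc (pullback_comm pb2) -comp_assoc e comp_assoc eb.
    exists u; split=> //; apply: (pullback_eq pb2); first by rewrite comp_assoc m21.
    by rewrite comp_assoc m22 -comp_assoc u2.
  - by move=> X u v e e'; apply: (pullback_eq pb1) => //; rewrite -m21 -!comp_assoc e.
have [|m3 [m31 m32]] := @pullback_ex _ _ _ _ _ _ _ _ _ _ (ka ∘ r1) r2 pb'.
  by rewrite comp_assoc -ea (pullback_comm pb2).
have h3 : IsOrthogonal V m3.
  apply: (orthogonal_pullback hka (t := p1') (pZ := r1)); apply: pullback_intro => //.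
  - move=> X x y e; have [|u [u1 u2]] := @pullback_ex _ _ _ _ _ _ _ _ _ _ y (p2' ∘ x) pb2.
      by rewrite ea -comp_assoc -e !comp_assoc (pullback_comm pb').
    exists u; split=> //; apply: (pullback_eq pb'); last by rewrite comp_assoc m32.
    by rewrite comp_assoc m31 -comp_assoc u1.
  - by move=> X u v e e'; apply: (pullback_eq pb2) => //; rewrite -m32 -!comp_assoc e.
have -> : n = m3 ∘ (m2 ∘ m1).
  apply: (pullback_eq pb').
  - by rewrite n1 comp_assoc m31 -comp_assoc (comp_assoc r1) m21 m11.
  - by rewrite n2 comp_assoc m32 comp_assoc m22 -comp_assoc m12.
by apply: (orthogonal_comp h3); apply: orthogonal_comp.
Qed.

(** * The closed subtopos as a topos, and its reflection *)

Lemma fullsub_pullback (C : Category) (Q : C -> Prop) (A B X P : FullSub Q)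
  (a : Hom A X) (b : Hom B X) (p1 : Hom P A) (p2 : Hom P B) :
  @IsPullback C (proj1_sig A) (proj1_sig B) (proj1_sig X) (proj1_sig P) a b p1 p2 ->
  IsPullback a b p1 p2.
Proof.
by move=> [e h]; split=> // -[Y hY] x y exy; apply: (h Y x y exy).
Qed.

(** The inclusion is a right adjoint, but its left adjoint is constructed below out of this lemma.
    Limits of closed objects are therefore compared with those of [E], which are closed. *)
Lemma closed_incl_lex (E : Topos) (V : E) : IsSubterminal V ->
  PreservesFiniteLimits (full_incl (InClosedSubtopos V)).
Proof.
move=> sV; have cl Y := closedob_iff Y sV.
have clo (Y : FullSub (InClosedSubtopos V)) : ClosedOb V (proj1_sig Y) by apply/cl; case: Y.
split.
- move=> T hT; have h1 : InClosedSubtopos V (one E).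
    by apply/cl/closedob_terminal/one_terminal.
  case: (hT (exist _ _ h1)) => u0 _ X /=; pose u : Hom (one E) (proj1_sig T) := u0.
  apply: (@ex_unique (Hom X (proj1_sig T)) _ (u ∘ bang X)) => // y _.
  have e : u ∘ (bang (proj1_sig T)) = idm (proj1_sig T).
    by apply: (@terminal_eq (FullSub (InClosedSubtopos V)) T T).
  by rewrite -(comp_idl y) -e -comp_assoc; congr (_ ∘ _); apply: bang_eq.
- move=> A B X P a b p1 p2 pb /=.
  case: (has_pullbacks (topos_axioms E) (a : Hom (proj1_sig A) (proj1_sig X)) b) => Q [q1 [q2 pbQ]].
  have hQ : InClosedSubtopos V Q.
    by apply/cl; exact: (closedob_pullback (clo A) (clo B) (clo X) pbQ).
  case: (@pullback_ex (FullSub (InClosedSubtopos V)) _ _ _ _ _ _ _ _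
    (exist _ Q hQ) q1 q2 pb); first exact: (pullback_comm pbQ).
  move=> j0 [j1 j2]; pose j : Hom Q (proj1_sig P) := j0.
  case: (pullback_ex pbQ (pullback_comm pb)) => i [i1 i2].
  have ji : j ∘ i = idm (proj1_sig P).
    apply: (@pullback_eq (FullSub (InClosedSubtopos V)) _ _ _ _ _ _ _ _ P _ _ pb).
    + by rewrite /= comp_assoc; rewrite /= in j1; rewrite j1 i1 comp_idr.
    + by rewrite /= comp_assoc; rewrite /= in j2; rewrite j2 i2 comp_idr.
  apply: pullback_intro; first exact: (pullback_comm pb).
  + move=> Y x y /(pullback_ex pbQ) [u [u1 u2]]; exists (j ∘ u).
    split; rewrite comp_assoc -?u1 -?u2; congr (_ ∘ _); [exact: j1|exact: j2].
  + move=> Y u v e1 e2; rewrite -(comp_idl u) -(comp_idl v) -ji -!comp_assoc; congr (_ ∘ _).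
    by apply: (pullback_eq pbQ); rewrite !comp_assoc ?i1 ?i2.
Qed.

Lemma fullsub_product (C : Category) (Q : C -> Prop) (A B P : FullSub Q)
  (p1 : Hom P A) (p2 : Hom P B) :
  @IsProduct C (proj1_sig A) (proj1_sig B) (proj1_sig P) p1 p2 -> IsProduct p1 p2.
Proof. by move=> h [X hX] a b; apply: (h X a b). Qed.

Lemma fullsub_exponential (C : Category) (Q : C -> Prop) (A B X P : FullSub Q)
  (p1 : Hom P X) (p2 : Hom P A) (ev : Hom P B) :
  (forall (Y Z : FullSub Q) (q1 : Hom Z Y) (q2 : Hom Z A), IsProduct q1 q2 ->
    @IsProduct C (proj1_sig Y) (proj1_sig A) (proj1_sig Z) q1 q2) ->
  @IsExponential C (proj1_sig A) (proj1_sig B) (proj1_sig X) (proj1_sig P) p1 p2 ev ->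
  IsExponential p1 p2 ev.
Proof.
move=> hq [hP he]; split; first exact: fullsub_product.
by move=> Y Z q1 q2 /hq /he.
Qed.

Lemma closed_topos (E : Topos) (V : E) : IsSubterminal V ->
  IsElementaryTopos (FullSub (InClosedSubtopos V)).
Proof.
move=> sV; have cl Y := closedob_iff Y sV; have lex := closed_incl_lex sV.
have clo (Y : FullSub (InClosedSubtopos V)) : ClosedOb V (proj1_sig Y) by apply/cl; case: Y.
have t1 : InClosedSubtopos V (one E) by apply/cl/closedob_terminal/one_terminal.
have ht1 : @IsTerminal (FullSub (InClosedSubtopos V)) (exist _ _ t1).
  by move=> [X hX]; apply: (one_terminal X).
have hpb (A B D : FullSub (InClosedSubtopos V)) (a : Hom A D) (b : Hom B D) :
  exists (P : FullSub (InClosedSubtopos V)) (p1 : Hom P A) (p2 : Hom P B), IsPullback a b p1 p2.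
  case: (has_pullbacks (topos_axioms E) (a : Hom (proj1_sig A) (proj1_sig D)) b) => P [p1 [p2 pb]].
  have hP : InClosedSubtopos V P.
    by apply/cl; exact: (closedob_pullback (clo A) (clo B) (clo D) pb).
  by exists (exist _ P hP), p1, p2; apply: fullsub_pullback.
split=> //; first by exists (exist _ _ t1).
- move=> [A hA] [B hB].
  have hX : InClosedSubtopos V (exponential A B) by apply/cl/closedob_exponential/cl.
  have hP : InClosedSubtopos V (exponential A B × A).
    apply/cl/(closedob_pullback (a := bang _) (b := bang _) (p1 := pfst) (p2 := psnd)).
    + exact/cl.
    + exact/cl.
    + exact/closedob_terminal/one_terminal.
    + exact/product_terminal_pullback/prd_product/one_terminal.
  exists (exist _ _ hX), (exist _ _ hP), pfst, psnd, ev.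
  apply: fullsub_exponential; last exact: ev_exponential.
  move=> Y Z q1 q2 hZ; apply: (lex_product _ lex hZ).
  by exists (exist _ _ t1).
- case: (closed_truth_ex V) => J [j [mj cJ jV hJ]].
  have hcJ : InClosedSubtopos V J by apply/cl.
  have [|t ht] := hJ _ (truth (one E)); first by move=> X r _; apply: tt_comp.
  exists (exist _ _ t1), (exist _ _ hcJ), t; apply: classifier_intro => // A X m mm.
  have mm' : @IsMono E (proj1_sig A) (proj1_sig X) m by apply: (lex_mono lex mm).
  have [cA cX] := (clo A, clo X).
  case: (chi_ex mm') => chi hchi; have [|c hc] := hJ _ chi.
    move=> Y x v; apply/hchi; case: (cA _ v) => -[s] _; exists s; exact: (proj2 (cX _ v)).
  have eqv (c' : Hom (proj1_sig X) J) (Y : E) (x : Hom Y (proj1_sig X)) :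
    (exists b : Hom Y (one E), c' ∘ x = t ∘ b) <-> holds ((j ∘ c') ∘ x).
    split=> [[b e]|e].
    + by rewrite -comp_assoc e comp_assoc ht; apply: tt_comp.
    + by exists (bang Y); apply: mj; rewrite !comp_assoc e ht tt_comp.
  exists c; split.
  + by move=> Y x; rewrite (eqv c) hc hchi.
  + move=> c' h'; apply: mj; apply: omega_ext => Y x; rewrite hc hchi -eqv.
    have [b0 hb0] : exists b0, (c' : Hom (proj1_sig X) J) ∘ m = t ∘ b0.
      by apply/(h' A m); exists (idm (proj1_sig A)); rewrite comp_idr.
    split.
    * move=> [s <-]; exists ((b0 : Hom (proj1_sig A) (one E)) ∘ s).
      by rewrite !comp_assoc; congr (_ ∘ _).
    (* [h'] speaks of closed test objects while [Y] is arbitrary, so [x] is passed through the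
       pullback [K] of [t] along [c'], which is closed. *)
    * move=> [b e]; case: (has_pullbacks (topos_axioms E) (c' : Hom (proj1_sig X) J) t).
      move=> K [n [n' pbK]]; case: (pullback_ex pbK e) => u [<- _].
      have hK : InClosedSubtopos V K.
        by apply/cl; apply: (closedob_pullback cX _ cJ pbK); apply/cl.
      have [s hs] : exists s, @comp E _ _ _ m s = n.
        by apply/(h' (exist _ K hK) n); exists n'; apply: pullback_comm pbK.
      by exists (@comp E _ _ _ s u); rewrite -hs comp_assoc.
Qed.

(** The exponential of [E] is closed too, and the comparison maps satisfy [j ∘ i = idm]; this
    carries transposes, with their uniqueness, over to the given exponential. *)
Lemma closed_incl_exponentials (E : Topos) (V : E) : IsSubterminal V ->
  PreservesExponentials (full_incl (InClosedSubtopos V)).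
Proof.
move=> sV A B X P p1 p2 evX hX /=; have cl Y := closedob_iff Y sV.
have lex := closed_incl_lex sV.
have ht : exists T : FullSub (InClosedSubtopos V), IsTerminal T.
  exact: (has_terminal (closed_topos sV)).
have hP : @IsProduct E (proj1_sig X) (proj1_sig A) (proj1_sig P) p1 p2.
  exact: (lex_product ht lex (proj1 hX)).
have cB : ClosedOb V (proj1_sig B) by apply/cl; case: (B).
have cA : ClosedOb V (proj1_sig A) by apply/cl; case: (A).
have hEX : InClosedSubtopos V (exponential (proj1_sig A) (proj1_sig B)).
  by apply/cl/closedob_exponential.
have hEP : InClosedSubtopos V (exponential (proj1_sig A) (proj1_sig B) × proj1_sig A).
  apply/cl; apply: (closedob_pullback (a := bang _) (b := bang _) (p1 := pfst) (p2 := psnd)).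
  - exact/cl.
  - exact: cA.
  - exact/closedob_terminal/one_terminal.
  - exact/product_terminal_pullback/prd_product/one_terminal.
pose XE : FullSub (InClosedSubtopos V) := exist _ _ hEX.
pose PE : FullSub (InClosedSubtopos V) := exist _ _ hEP.
have hPE : @IsProduct (FullSub (InClosedSubtopos V)) XE A PE pfst psnd.
  exact/fullsub_product/prd_product.
case: (@exponential_transpose (FullSub (InClosedSubtopos V)) _ _ _ _ _ _ _ XE PE _ _ ev hX hPE).
move=> j hj.
case: (@product_ex E _ _ _ _ _ _
  (@comp E (proj1_sig PE) (proj1_sig XE) (proj1_sig X) j pfst) psnd hP) => k0 [k01 k02].
have k03 := hj k0 k01 k02.
pose evE : @Hom E (proj1_sig P) (proj1_sig B) := evX.
pose p1E : @Hom E (proj1_sig P) (proj1_sig X) := p1.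
case: (exponential_transpose evE (@ev_exponential E (proj1_sig A) (proj1_sig B)) hP) => i hi.
pose w : Hom (proj1_sig P) (exponential (proj1_sig A) (proj1_sig B) × proj1_sig A) :=
  ⟨i ∘ p1E, p2⟩.
have hw : ev ∘ w = evE by apply: hi; rewrite ?fst_pair ?snd_pair.
have ji : @comp E _ _ _ j i = idm (proj1_sig X).
  apply: (@exponential_eq (FullSub (InClosedSubtopos V)) _ _ _ _ _ _ _ X P p1 p2
    (@comp E _ _ _ j i) (idm X) (@comp E _ _ _ k0 w) (idm P) hX (proj1 hX)) => /=.
  - by rewrite comp_assoc k01 -!comp_assoc fst_pair.
  - by rewrite comp_assoc k02 snd_pair.
  - by rewrite comp_idl comp_idr.
  - by rewrite comp_idr.
  - by rewrite comp_assoc; rewrite /= in k03; rewrite k03 hw comp_idr.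
split=> // Y Z q1 q2 hZ g.
case: (exponential_transpose g (@ev_exponential E (proj1_sig A) (proj1_sig B)) hZ) => h0 hh0.
have e0 : ev ∘ ⟨h0 ∘ q1, q2⟩ = g by apply: hh0; rewrite ?fst_pair ?snd_pair.
apply: (@ex_unique (Hom Y (proj1_sig X)) _ (@comp E _ _ _ j h0)).
- exists (@comp E _ _ _ k0 ⟨h0 ∘ q1, q2⟩); split; [|split].
  + by rewrite comp_assoc k01 -!comp_assoc fst_pair.
  + by rewrite comp_assoc k02 snd_pair.
  + by rewrite comp_assoc; rewrite /= in k03; rewrite k03 e0.
- move=> h' [k [k1 [k2 k3]]].
  suff -> : h0 = i ∘ h' by rewrite comp_assoc ji comp_idl.
  apply: (exponential_eq (@ev_exponential E (proj1_sig A) (proj1_sig B)) hZ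
    (k := ⟨h0 ∘ q1, q2⟩) (k' := w ∘ k)).
  + by rewrite fst_pair.
  + by rewrite snd_pair.
  + by rewrite comp_assoc fst_pair -!comp_assoc k1.
  + by rewrite comp_assoc snd_pair.
  + by rewrite e0 comp_assoc hw.
Qed.

(** For closed [O] the exponential of [O] by any [Z] is closed, which supplies the representing
    object that [exponential_universal_exists] asks for. *)
Lemma closed_reflection_exists (E : Topos) (V : E) : IsSubterminal V ->
  forall Z : E, exists (L : FullSub (InClosedSubtopos V))
    (eta : Hom Z (full_incl (InClosedSubtopos V) L)), IsUniversal eta.
Proof.
move=> sV; have cl Y := closedob_iff Y sV.
pose FT := Build_Topos (closed_topos sV).
apply: (@exponential_universal_exists FT E (full_incl (InClosedSubtopos V))).
- exact: closed_incl_lex.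
- exact: closed_incl_exponentials.
- move=> [O hO] Z; have hA : InClosedSubtopos V (exponential Z O).
    by apply/cl/closedob_exponential/cl.
  exists (exist _ _ hA), ev => -[T hT] g /=.
  apply: (@ex_unique (Hom T (exponential Z O)) _ (curry g)).
  + by rewrite ev_curry pair_id comp_idr.
  + move=> t <-; apply: curry_eq => X x z; rewrite ev_curry -comp_assoc pair_comp.
    by rewrite -comp_assoc fst_pair snd_pair.
Qed.

(** * Equivalences *)

Definition FullyFaithful (C D : Category) (K : Functor C D) : Prop :=
  forall (X Y : C) (z : Hom (K X) (K Y)), exists ! x : Hom X Y, fmap K x = z.

Lemma faithful_of_natiso (C D : Category) (K : Functor C D) (K1 : Functor D C) (X Y : C)
  (x y : Hom X Y) :
  NatIsomorphic (functor_comp K1 K) (functor_id C) -> fmap K x = fmap K y -> x = y.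
Proof.
move=> [al [nat iso]] e; case: (iso X) => w [_ w2].
have h : x ∘ al X = y ∘ al X by rewrite -(nat _ _ x) -(nat _ _ y) /= e.
by rewrite -(comp_idr x) -(comp_idr y) -w2 !comp_assoc h.
Qed.

Lemma quasi_inverse_fully_faithful (C D : Category) (K : Functor C D) (K1 : Functor D C) :
  NatIsomorphic (functor_comp K1 K) (functor_id C) ->
  NatIsomorphic (functor_comp K K1) (functor_id D) -> FullyFaithful K.
Proof.
move=> ha hb X Y z; case: (ha) => al [nat iso]; case: (iso X) => w [w1 w2].
apply: (@ex_unique _ _ (al Y ∘ fmap K1 z ∘ w)).
- apply: (faithful_of_natiso hb); apply: (iso_mono (iso Y)).
  rewrite (nat _ _ (al Y ∘ fmap K1 z ∘ w)) /= -comp_assoc w1 comp_idr //.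
- move=> x <-; rewrite (nat _ _ x) /= -comp_assoc w2 comp_idr //.
Qed.

(** The isomorphism [be] is kept as counit, and the unit is the preimage of its inverse under the
    fully faithful [K]; so no coherence between the two given isomorphisms is required. *)
Lemma quasi_inverse_adjunction (C D : Category) (K : Functor C D) (K1 : Functor D C) :
  NatIsomorphic (functor_comp K1 K) (functor_id C) ->
  NatIsomorphic (functor_comp K K1) (functor_id D) -> inhabited (Adjunction K K1).
Proof.
move=> ha hb; have ff := quasi_inverse_fully_faithful ha hb.
case: (hb) => be [nat iso].
have ex X : exists t : Hom X (K1 (K X)), be (K X) ∘ fmap K t = idm (K X).
  case: (iso (K X)) => w [_ w2]; case: (ff _ _ (w : Hom (K X) (K (K1 (K X))))) => t [ht _].
  by exists t; rewrite ht.
pose un X := proj1_sig (constructive_indefinite_description _ (ex X)).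
have hun X : be (K X) ∘ fmap K (un X) = idm (K X).
  by rewrite /un; case: constructive_indefinite_description.
have eq X Y (t t' : Hom X (K1 Y)) : be Y ∘ fmap K t = be Y ∘ fmap K t' -> t = t'.
  by move=> /(iso_mono (iso Y)); apply: faithful_of_natiso ha.
have nat' X Y (u : Hom X Y) : be Y ∘ fmap K (fmap K1 u) = u ∘ be X := nat X Y u.
constructor; refine (@Build_Adjunction C D K K1 un be _ _ _ _).
- move=> X X' u; apply: eq; rewrite !fmap_comp !comp_assoc hun nat' -comp_assoc hun.
  by rewrite comp_idl comp_idr.
- by move=> Y Y' v; rewrite nat'.
- exact: hun.
- move=> Y; apply: eq; rewrite fmap_comp comp_assoc nat' -comp_assoc hun.
  by rewrite fmap_id.
Qed.

Lemma right_adjoint_lex (C D : Category) (L : Functor C D) (R : Functor D C) :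
  Adjunction L R -> PreservesFiniteLimits R.
Proof.
move=> a; split.
- move=> T hT X; case: (hT (L X)) => t _; apply: (@ex_unique _ _ (fmap R t ∘ adj_unit a X)) => //.
  move=> y _; rewrite -(transpose_unit a y); congr (fmap R _ ∘ _); exact: terminal_eq.
- move=> A B X P u v p1 p2 pb; apply: pullback_intro.
  + exact/fmap_sq/pullback_comm.
  + move=> Y x y e; have [|w [w1 w2]] := @pullback_ex _ _ _ _ _ _ _ _ _ _
      (transpose a x) (transpose a y) pb.
      by rewrite -!transpose_fmap e.
    exists (fmap R w ∘ adj_unit a Y).
    by rewrite !comp_assoc -!fmap_comp w1 w2 !transpose_unit.
  + move=> Y x y e1 e2; rewrite -(transpose_unit a x) -(transpose_unit a y).
    congr (fmap R _ ∘ _); apply: (pullback_eq pb); rewrite -!transpose_fmap ?e1 ?e2 //.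
Qed.

Lemma subterminal_right_adjoint (C D : Category) (L : Functor C D) (R : Functor D C)
  (a : Adjunction L R) (U : D) : IsSubterminal U -> IsSubterminal (R U).
Proof.
move=> sU T u v; rewrite -(transpose_unit a u) -(transpose_unit a v).
by congr (fmap R _ ∘ _); apply: sU.
Qed.

Lemma fully_faithful_comp (C D E : Category) (F : Functor C D) (G : Functor D E) :
  FullyFaithful F -> FullyFaithful G -> FullyFaithful (functor_comp G F).
Proof.
move=> hF hG X Y z; case: (hG _ _ z) => y [<- uy]; case: (hF _ _ y) => x [<- ux].
apply: (@ex_unique _ _ x) => //= x' e; apply: ux.
exact: (unique_eq (hG _ _ (fmap G (fmap F x)))).
Qed.

Lemma fully_faithful_natiso (C D : Category) (F G : Functor C D) :
  NatIsomorphic F G -> FullyFaithful G -> FullyFaithful F.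
Proof.
move=> [eta [nat iso]] hG X Y z; case: (iso X) => w [w1 w2].
case: (hG X Y (eta Y ∘ z ∘ w)) => x [hx ux]; apply: (@ex_unique _ _ x).
- apply: (iso_mono (iso Y)); rewrite nat hx -!comp_assoc w1 comp_idr //.
- move=> x' e; apply: ux; rewrite -e nat -comp_assoc w2 comp_idr //.
Qed.

(** A closed inclusion followed by an étale morphism presents [S] as a closed
    subtopos of a slice of [E]. *)
Lemma closed_etale_presentation (E S G : Topos) (p : GeomMor S E) (c : GeomMor S G)
  (e : GeomMor G E) :
  IsClosedInclusion c -> IsEtale e -> GeomIso p (geom_comp e c) ->
  exists (A : E) (H : Functor E (Slice A)) (V : Slice A) (R : Functor S (Slice A))
    (L : Functor (Slice A) S),
    IsPullbackToSlice H /\ IsSubterminal V /\ inhabited (Adjunction L R) /\ FullyFaithful R /\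
    (forall X, ClosedOb V (R X)) /\
    (forall Z, ClosedOb V Z -> exists (X : S) (th : Hom Z (R X)), IsIso th) /\
    NatIsomorphic (inv p) (functor_comp L H).
Proof.
move=> [U [K' [sU [[K1' [ha' hb']] hdir]]]] [A [H [K [hH [[K1 [ha hb]] hinv]]]]] hp.
case: (quasi_inverse_adjunction ha hb) => aK; case: (quasi_inverse_adjunction hb ha) => aK1.
have cl Y := closedob_iff Y sU.
(* The closed subtopos lives in [G]; the quasi-inverse [K1] carries its subterminal object and its
   inclusion over to the slice. *)
exists A, H, (K1 U), (functor_comp K1 (dir c)), (functor_comp (inv c) K).
split; first by [].
split; first exact: (subterminal_right_adjoint aK).
split; first by constructor; apply: (adj_comp aK (inv_dir c)).
split.
  apply: fully_faithful_comp (quasi_inverse_fully_faithful hb ha).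
  apply: (fully_faithful_natiso hdir); apply: fully_faithful_comp.
  - exact: quasi_inverse_fully_faithful ha' hb'.
  - by move=> X Y z; apply: (@ex_unique _ _ z).
case: (natiso_sym hdir) => et [_ iet].
split.
  move=> X /=; apply: (closedob_right_adjoint aK); apply: (closedob_iso (iet X)).
  by apply/cl; apply: proj2_sig.
split; last first.
  apply: (natiso_trans hp); apply: natiso_trans (natiso_comp hinv (natiso_refl (inv c))) _.
  exact: (natiso_refl (functor_comp (functor_comp (inv c) K) H)).
(* An object closed for [K1 U] becomes closed for [U] under [K], hence comes from [S] up to
   isomorphism. *)
move=> Z hZ; have hKZ : InClosedSubtopos U (K Z).
  apply/cl; case: (natiso_sym hb) => et' _.
  exact: (closedob_map (et' U) (closedob_right_adjoint aK1 hZ)).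
case: (natiso_sym hb') => be [_ ibe].
pose Y : FullSub (InClosedSubtopos U) := exist _ (K Z) hKZ.
case: (natiso_sym ha) => al [_ ial].
exists (K1' Y), (fmap K1 (et (K1' Y)) ∘ fmap K1 (be Y : Hom (K Z) (proj1_sig (K' (K1' Y)))) ∘ al Z).
apply: iso_comp; last exact: ial.
apply: iso_comp; apply: iso_fmap; first exact: iet.
exact: (ibe Y).
Qed.

(** * Base change along a closed subtopos of a slice *)

(** Maps [T -> Z] are maps [R T -> Y], and [R T] lies over [R V] when [T] lies over [V]. *)
Lemma closed_couniversal (C D : Category) (R : Functor C D) (V Z : C) (Y : D)
  (eps : Hom (R Z) Y) : IsCouniversal eps -> ClosedOb (R V) Y -> ClosedOb V Z.
Proof.
move=> h hY T v; case: (hY _ (fmap R v)) => -[y] uy; split.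
  by case: (h _ y) => x _; exact: (inhabits x).
by move=> x x'; apply: (couniversal_eq h); apply: uy.
Qed.

(** [R] embeds [S] as the closed subtopos of [E/A] complementary to [V], and
    [slice_functor (inv g) A] is the inverse image of the base change of [g]. *)
Lemma unit_orthogonal (F E : Topos) (g : GeomMor F E) (S : Category) (A : E) (V : Slice A)
  (R : Functor S (Slice A)) (L : Functor (Slice A) S) (a : Adjunction L R) :
  FullyFaithful R ->
  (forall Z, ClosedOb V Z -> exists (X : S) (th : Hom Z (R X)), IsIso th) ->
  forall Z, IsOrthogonal (slice_functor (inv g) A V)
    (fmap (slice_functor (inv g) A) (adj_unit a Z)).
Proof.
set gA := slice_functor (inv g) A => ff ess Z Y hY y.
(* The direct image [C] of the closed object [Y] is closed, thus isomorphic to some [R X]. Maps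
   [gA Z -> Y] become maps [Z -> R X], which factor uniquely through the unit. *)
case: (slice_couniversal_exists Y) => C [eps heps].
case: (ess C (closed_couniversal heps hY)) => X [th [th' [t1 t2]]].
case: (heps _ y) => t [ht _].
apply: (@ex_unique _ _ (eps ∘ fmap gA (th' ∘ fmap R (transpose a (th ∘ t))))).
- rewrite -comp_assoc -fmap_comp -comp_assoc transpose_unit comp_assoc t1 comp_idl //.
- move=> y' e; case: (heps _ y') => s [hs _]; rewrite -hs; congr (_ ∘ fmap gA _).
  case: (ff _ _ (th ∘ s)) => x [hx _].
  have -> : s = th' ∘ fmap R x by rewrite hx comp_assoc t1 comp_idl.
  congr (_ ∘ fmap R _); apply: (universal_eq (unit_universal a Z)).
  rewrite transpose_unit hx -comp_assoc; congr (_ ∘ _); apply: (couniversal_eq heps).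
  by rewrite ht fmap_comp comp_assoc hs e.
Qed.

Definition base_change_ob (F E S : Topos) (g : GeomMor F E) (A : E) (V : Slice A)
  (R : Functor S (Slice A)) (hV : IsSubterminal V) (hR : forall X, ClosedOb V (R X)) (X : S) :
  FullSub (InClosedSubtopos (slice_functor (inv g) A V)) :=
  exist _ (slice_functor (inv g) A (R X))
    (closedob_closed_subtopos
      (@subterminal_lex (Build_Topos (slice_topos A)) _ _ _ (slice_functor_lex A (inv_lex g)) hV)
      (@closedob_lex (Build_Topos (slice_topos A)) _ _ _ _ (slice_functor_lex A (inv_lex g)) hV
        (hR X))).

(** Since [gA] sends closed objects to closed objects, this inverse image involves no reflection. *)
Definition base_change_functor (F E S : Topos) (g : GeomMor F E) (A : E) (V : Slice A)
  (R : Functor S (Slice A)) (hV : IsSubterminal V) (hR : forall X, ClosedOb V (R X)) :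
  Functor S (FullSub (InClosedSubtopos (slice_functor (inv g) A V))).
Proof.
refine (@Build_Functor S (FullSub (InClosedSubtopos (slice_functor (inv g) A V)))
  (base_change_ob g hV hR)
  (fun X Y u => fmap (functor_comp (slice_functor (inv g) A) R) u) _ _).
- by move=> X; apply: (fmap_id (functor_comp (slice_functor (inv g) A) R)).
- by move=> X Y Z v u; apply: (fmap_comp (functor_comp (slice_functor (inv g) A) R)).
Defined.

Lemma base_change_stable (F E S : Topos) (g : GeomMor F E) (A : E) (V : Slice A)
  (R : Functor S (Slice A)) (L : Functor (Slice A) S)
  (hV : IsSubterminal V) (hR : forall X, ClosedOb V (R X)) :
  EILC S -> (forall X : F, exists (L : E) (eta : Hom X (inv g L)), IsUniversal eta) ->
  Adjunction L R -> FullyFaithful R ->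
  (forall Z, ClosedOb V Z -> exists (X : S) (th : Hom Z (R X)), IsIso th) ->
  UniversalsStable (base_change_functor g hV hR).
Proof.
move=> hS huniv a ff ess; set gA := slice_functor (inv g) A; set rho := base_change_functor g hV hR.
have lexA : PreservesFiniteLimits gA := slice_functor_lex A (inv_lex g).
have lexR := right_adjoint_lex a.
have sV : IsSubterminal (gA V).
  exact: (@subterminal_lex (Build_Topos (slice_topos A)) _ _ _ lexA hV).
pose FT := Build_Topos (@closed_topos (Build_Topos (slice_topos (inv g A))) _ sV).
have lex : PreservesFiniteLimits rho.
  split.
  - move=> T /(pres_terminal lexR) /(pres_terminal lexA) h [X hX]; exact: (h X).
  - move=> X Y Z P x y p1 p2 /(pres_pullback lexR) /(pres_pullback lexA) h.
    exact: (@fullsub_pullback (Slice (inv g A)) _ (rho X) (rho Y) (rho Z) (rho P) _ _ _ _ h).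
(* The direct image is that of the slices: its value at a closed object is closed and so comes from
   [S]. *)
have [|D [ad]] := @right_adjoint_exists S FT rho.
  move=> Y; have cY : ClosedOb (gA V) (proj1_sig Y).
    apply/(@closedob_iff (Build_Topos (slice_topos (inv g A))) _ _ sV); exact: (proj2_sig Y).
  case: (slice_couniversal_exists (proj1_sig Y)) => Z [eps heps].
  case: (ess Z (closed_couniversal heps cY)) => X [th [th' [t1 t2]]].
  exists X, (eps ∘ fmap gA th') => X' y.
  case: (heps _ y) => t [ht ut]; case: (ff _ _ (th ∘ t)) => x [hx ux].
  apply: (@ex_unique _ _ x).
  - change ((eps ∘ fmap gA th') ∘ fmap gA (fmap R x) = y).
    by rewrite -comp_assoc -fmap_comp hx comp_assoc t1 comp_idl.
  - move=> x' e; apply: ux; have : (eps ∘ fmap gA th') ∘ fmap gA (fmap R x') = y := e.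
    by rewrite -comp_assoc -fmap_comp => /ut ->; rewrite comp_assoc t2 comp_idl.
pose h : GeomMor FT S := @Build_GeomMor FT S D rho ad lex.
suff hess : IsEssential h by exact: (locally_connected_stable (hS FT h hess)).
(* The left adjoint is [g_!] of the total object, taken over [A] by way of [z], followed by [L]. *)
apply: left_adjoint_exists => Y.
case: (huniv (projT1 (proj1_sig Y))) => Z [eta heta].
case: (heta _ (projT2 (proj1_sig Y))) => z [hz _].
pose e1 : Hom (proj1_sig Y) (gA (slice_mk z)) :=
  slice_hom_mk (proj1_sig Y) (gA (slice_mk z)) hz.
have ue1 : IsUniversal e1 by apply: slice_universal.
exists (L (slice_mk z)), (fmap gA (adj_unit a (slice_mk z)) ∘ e1).
exact: (universal_comp ue1 (unit_universal a (slice_mk z))).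
Qed.

(** * The comparison map at one point *)

Lemma pullback_functor_map (F E : Topos) (g : GeomMor F E) (A : E) (H : Functor E (Slice A))
  (pr : forall X : E, Hom (projT1 (H X)) X) (X : F) (L : E) (y : Hom X (inv g L)) :
  (forall X : E, IsProduct (pr X) (projT2 (H X))) ->
  exists n : Hom (slice_mk (@psnd F X (inv g A))) (slice_functor (inv g) A (H L)),
    fmap (inv g) (pr L) ∘ proj1_sig n = y ∘ pfst.
Proof.
move=> hpr.
have hp : IsProduct (fmap (inv g) (pr L)) (fmap (inv g) (projT2 (H L))).
  by apply: lex_product (inv_lex g) (hpr L); apply: has_terminal (topos_axioms E).
case: (product_ex (y ∘ pfst) (@psnd F X (inv g A)) hp) => n [n1 n2].
by exists (slice_hom_mk (slice_mk (@psnd F X (inv g A))) (slice_functor (inv g) A (H L)) n2).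
Qed.

(** The inverse image of the point is [L] after [H]. Both [L (H M)] and [L (H Q)] receive universal
    arrows out of the same object [P × g^*A], for the functor [gA] after [R], and the image of [m]
    carries one to the other. *)
Lemma comparison_iso (F E S : Topos) (g : GeomMor F E) (A : E) (V : Slice A)
  (H : Functor E (Slice A)) (R : Functor S (Slice A)) (L : Functor (Slice A) S) :
  EILC S -> PreservesExponentials (inv g) ->
  IsPullbackToSlice H -> IsSubterminal V -> Adjunction L R -> FullyFaithful R ->
  (forall X, ClosedOb V (R X)) ->
  (forall Z, ClosedOb V Z -> exists (X : S) (th : Hom Z (R X)), IsIso th) ->
  forall (X : F) (B : E) (eta : Hom X (inv g B)) (Q : E) (v : Hom Q B)
    (P : F) (p1 : Hom P X) (p2 : Hom P (inv g Q)) (M : E) (eta' : Hom P (inv g M)) (m : Hom M Q),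
    IsUniversal eta -> IsPullback eta (fmap (inv g) v) p1 p2 -> IsUniversal eta' ->
    fmap (inv g) m ∘ eta' = p2 -> IsIso (fmap L (fmap H m)).
Proof.
move=> hS hx [pr [hpr hprn]] hV a ff hR ess X B eta Q v P p1 p2 M eta' m ueta pb ueta' hm.
have huniv := inverse_image_universal_exists hx.
have stable := base_change_stable (hV := hV) (hR := hR) hS huniv a ff ess.
set gA := slice_functor (inv g) A; set rho := base_change_functor g hV hR in stable.
set D := inv g A.
have lexA : PreservesFiniteLimits gA := slice_functor_lex A (inv_lex g).
pose TB := Build_Topos (slice_topos D).
have sV : @IsSubterminal TB (gA V).
  exact: (@subterminal_lex (Build_Topos (slice_topos A)) _ _ _ lexA hV).
have hgpr Y : IsProduct (fmap (inv g) (pr Y)) (fmap (inv g) (projT2 (H Y))).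
  by apply: lex_product (inv_lex g) (hpr Y); apply: has_terminal (topos_axioms E).
have toH Y (T : Slice D) (s t : Hom T (gA (H Y))) :
  fmap (inv g) (pr Y) ∘ proj1_sig s = fmap (inv g) (pr Y) ∘ proj1_sig t -> s = t.
  move=> e; apply: slice_hom_eq; apply: (product_eq (hgpr Y) e).
  by rewrite (proj2_sig s : fmap (inv g) (projT2 (H Y)) ∘ proj1_sig s = _);
     rewrite (proj2_sig t : fmap (inv g) (projT2 (H Y)) ∘ proj1_sig t = _).
have uH (Y : F) (C : E) (y : Hom Y (inv g C)) (n : Hom (slice_mk (@psnd F Y D)) (gA (H C))) :
  fmap (inv g) (pr C) ∘ proj1_sig n = y ∘ pfst -> IsUniversal y -> IsUniversal n.
  move=> hn uy; apply: slice_universal.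
  exact: (universal_product hx uy (hpr C) (@prd_product F Y D) hn (proj2_sig n)).
case: (pullback_functor_map eta hpr) => nX hnX.
case: (pullback_functor_map p2 hpr) => nP hnP.
case: (pullback_functor_map eta' hpr) => nM hnM.
pose XD := slice_mk (@psnd F X D); pose PD := slice_mk (@psnd F P D).
have hxD : psnd ∘ ⟨p1 ∘ pfst, @psnd F P D⟩ = psnd by rewrite snd_pair.
pose xD : Hom PD XD := slice_hom_mk PD XD hxD.
have prn Y Z (u : Hom Y Z) : fmap (inv g) (pr Z) ∘ fmap (inv g) (proj1_sig (fmap H u)) =
  fmap (inv g) u ∘ fmap (inv g) (pr Y) by apply/fmap_sq/hprn.
have hnMP : fmap gA (fmap H m) ∘ nM = nP.
  by apply: toH; rewrite /= comp_assoc prn -comp_assoc hnM hnP comp_assoc hm.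
have pbD : IsPullback nX (fmap gA (fmap H v)) xD nP.
  apply/slice_pullback => /=; apply: pullback_intro.
  - apply: (f_equal (@proj1_sig _ _) (_ : nX ∘ xD = fmap gA (fmap H v) ∘ nP)).
    apply: toH; rewrite /= comp_assoc hnX comp_assoc prn -!comp_assoc hnP fst_pair.
    by rewrite !comp_assoc (pullback_comm pb).
  - move=> T x y e; have [|u [u1 u2]] := @pullback_ex _ _ _ _ _ _ _ _ _ _
      (pfst ∘ x) (fmap (inv g) (pr Q) ∘ y) pb.
      by rewrite comp_assoc -hnX -comp_assoc e comp_assoc prn comp_assoc.
    exists ⟨u, psnd ∘ x⟩; split.
    + apply: prd_eq; rewrite comp_assoc ?fst_pair ?snd_pair ?snd_pair //.
      by rewrite -comp_assoc fst_pair.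
    + apply: (product_eq (hgpr Q)); rewrite comp_assoc.
      * by rewrite hnP -comp_assoc fst_pair.
      * rewrite (proj2_sig nP : fmap (inv g) (projT2 (H Q)) ∘ proj1_sig nP = psnd) snd_pair.
        have hv : fmap (inv g) (projT2 (H B)) ∘ fmap (inv g) (proj1_sig (fmap H v)) =
          fmap (inv g) (projT2 (H Q)) := proj2_sig (fmap gA (fmap H v)).
        rewrite -hv.
        rewrite -comp_assoc -e comp_assoc.
        by rewrite (proj2_sig nX : fmap (inv g) (projT2 (H B)) ∘ proj1_sig nX = psnd).
  - move=> T s t e1 e2; apply: prd_eq.
    + apply: (pullback_eq pb).
      * have := f_equal (fun w => pfst ∘ w) e1.
        by rewrite !comp_assoc fst_pair -!comp_assoc.
      * by rewrite !comp_assoc -hnP -!comp_assoc e2.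
    + have := f_equal (fun w => psnd ∘ w) e1.
      by rewrite !comp_assoc snd_pair.
pose un Z := fmap gA (adj_unit a Z).
have hun (Y Z : Slice A) (u : Hom Y Z) : un Z ∘ fmap gA u = fmap gA (fmap R (fmap L u)) ∘ un Y.
  by rewrite /un -!fmap_comp adj_unit_nat.
have oun Z : IsOrthogonal (gA V) (un Z) by apply: unit_orthogonal.
(* [stable] concerns arrows out of closed objects, so [X × D] is replaced by its reflection [X']. *)
case: (@closed_reflection_exists TB (gA V) sV XD) => X' [k uk].
pose FC := FullSub (InClosedSubtopos (gA V)).
pose incl : Functor FC (Slice D) := full_incl (InClosedSubtopos (gA V)).
have cl (Y : FC) : ClosedOb (gA V) (proj1_sig Y).
  by apply/(@closedob_iff TB _ _ sV); case: Y.
have orth_of_univ (Z : Slice D) (Y : FC) (y : Hom Z (incl Y)) :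
  IsOrthogonal (gA V) y <-> IsUniversal (R := incl) y.
  split=> hy.
  - by move=> W w; apply: (hy _ (cl W)).
  - move=> W /(closedob_closed_subtopos sV) hW w; exact: (hy (exist _ W hW) w).
pose wX := un (H B) ∘ nX.
have uwX : IsUniversal (R := functor_comp gA R) wX.
  exact: (universal_comp (uH _ _ _ _ hnX ueta) (unit_universal a (H B))).
case: (uk (rho (L (H B))) wX) => x' [hx' _].
have ux' : IsUniversal (R := rho) x'.
  apply: (universal_cancel (R := incl) (R' := rho) uk).
  by change (IsUniversal (R := functor_comp gA R) (fmap incl x' ∘ k)); rewrite hx'.
case: (has_pullbacks (@closed_topos TB (gA V) sV) x' (fmap rho (fmap L (fmap H v)))) =>
  P' [p1' [p2' pb']].
have up2' : IsUniversal (R := rho) p2' := stable _ _ _ ux' _ _ _ _ _ pb'.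
have pbE := pres_pullback (@closed_incl_lex TB (gA V) sV) pb'.
have [|n [n1 n2]] := @pullback_ex _ _ _ _ _ _ _ _ _ PD (k ∘ xD) (un (H Q) ∘ nP) pbE.
  rewrite comp_assoc hx' /wX -comp_assoc (pullback_comm pbD) comp_assoc hun -comp_assoc //.
(* The pullback [pbD] in the slice and the pullback [pbE] of closed objects are linked by three
   orthogonal maps, so [P'] is the reflection of [P × D]. *)
have on : IsOrthogonal (gA V) n.
  apply: (@orthogonal_cube TB (gA V) _ _ _ _ _ _ _ _ _ _ _ _ _ _ _ _ k (un (H Q)) (un (H B)) n
    pbD pbE) => //.
  - exact/orth_of_univ.
have uP : IsUniversal (R := functor_comp gA R) (un (H Q) ∘ nP).
  rewrite -n2; exact: (universal_comp (proj1 (orth_of_univ _ _ _) on) up2').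
have uM : IsUniversal (R := functor_comp gA R) (un (H M) ∘ nM).
  exact: (universal_comp (uH _ _ _ _ hnM ueta') (unit_universal a (H M))).
apply: (universal_iso uM uP).
change (fmap gA (fmap R (fmap L (fmap H m))) ∘ (un (H M) ∘ nM) = un (H Q) ∘ nP).
by rewrite comp_assoc -hun -comp_assoc hnMP.
Qed.

Theorem theorem5p3 (E S : Topos) (f : GeomMor E S) (hN : HasNNO E)
  (hJ : IsWeaklyJacobson f) (hS : EILC S) : CILC E.
Proof.
move=> F g hx; have huniv := inverse_image_universal_exists hx.
apply: (stable_locally_connected huniv) => X B eta ueta Q v P p1 p2 pb.
(* [M] is the value of [g_!] at [P] and [m] is the comparison map; [p2] is universal as soon as [m]
   is invertible. *)
case: (huniv P) => M [eta' ueta']; case: (ueta' _ p2) => m [hm _].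
apply: (iso_universal ueta' _ hm).
case: hJ => I [p [_ [hsurj hfac]]]; apply: hsurj => i.
case: (hfac i) => G [c [e [hc [he hp]]]].
have [A [H [V [R [L [hH [hV [[a] [ff [hR [ess hLH]]]]]]]]]]] :=
  closed_etale_presentation hc he hp.
apply: (natiso_iso hLH).
exact: (comparison_iso hS hx hH hV a ff hR ess ueta pb ueta' hm).
Qed.
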